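(* Let $(R,\mathfrak m)$ be a Cohen-Macaulay local ring of dimension $d$ with $1\leq d\leq 2$ and infinite residue field, let $I_1,\ldots,I_s$ be $\mathfrak m$-primary ideals of $R$ and let $\mathcal F=\{\mathcal F(\underline n)\}_{\underline n\in\mathbb Z^s}$ be an $\underline I$-admissible filtration of ideals in $R$. Suppose $e_{(d-1)e_i}(\mathcal F)=0$ for all $i=1,\ldots,s$. Then: (1) For $d=1$, $P_{\mathcal F}(\underline n)=H_{\mathcal F}(\underline n)$ for all $\underline n\in\mathbb N^s$. (2) For $d=2$, if $H^1_{\mathcal R_{++}}(\mathcal R(\mathcal F))_{\underline n}=0$ for all $\underline n\in\mathbb N^s$, then $P_{\mathcal F}(\underline n)=H_{\mathcal F}(\underline n)$ for all $\underline n\in\mathbb N^s$ and $e_{\underline 0}(\mathcal F)=0$.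
   Context: Notation: $\mathbb N=\{0,1,2,\ldots\}$, $\lambda$ denotes length over $R$, $s\ge1$, $e=(1,\ldots,1)$, $\underline 0=(0,\dots,0)$, $e_i$ is the $i$-th standard basis vector of $\mathbb Z^s$; $\underline n\ge\underline m$ means componentwise inequality; $\underline n^+=(\max(n_1,0),\ldots,\max(n_s,0))$; $|\alpha|=\alpha_1+\cdots+\alpha_s$; $\underline I=(I_1,\ldots,I_s)$ and $\underline I^{\underline n}=I_1^{n_1}\cdots I_s^{n_s}$, where a nonpositive power of an ideal is $R$. ''For all large $\underline n$'' means for all $\underline n\in\mathbb N^s$ with every $n_i\gg0$. Filtrations: a $\mathbb Z^s$-graded $\underline I$-filtration is a family of ideals $\mathcal F=\{\mathcal F(\underline n)\}_{\underline n\in\mathbb Z^s}$ of $R$ with $\underline I^{\underline n}\subseteq\mathcal F(\underline n)$, $\mathcal F(\underline n)\mathcal F(\underline m)\subseteq\mathcal F(\underline n+\underline m)$, and $\mathcal F(\underline m)\subseteq\mathcal F(\underline n)$ whenever $\underline m\geq\underline n$. It is $\underline I$-admissible if moreover $\mathcal F(\underline n)=\mathcal F(\underline n^+)$ for all $\underline n$ and $\mathcal R'(\mathcal F)=\bigoplus_{\underline n\in\mathbb Z^s}\mathcal F(\underline n)\underline t^{\underline n}$ is a finite module over $\mathcal R'(\underline I)=\bigoplus_{\underline n\in\mathbb Z^s}\underline I^{\underline n}\underline t^{\underline n}$, where $t_1,\dots,t_s$ are indeterminates and $\underline t^{\underline n}=t_1^{n_1}\cdots t_s^{n_s}$. Rees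 rings: $\mathcal R(\mathcal F)=\bigoplus_{\underline n\in\mathbb N^s}\mathcal F(\underline n)\underline t^{\underline n}$, $\mathcal R(\underline I)=\bigoplus_{\underline n\in\mathbb N^s}\underline I^{\underline n}\underline t^{\underline n}$, and $\mathcal R_{++}=\bigoplus_{\underline n\ge e}\underline I^{\underline n}\underline t^{\underline n}$, an ideal of $\mathcal R(\underline I)$. $H^1_{\mathcal R_{++}}(\mathcal R(\mathcal F))$ is the first local cohomology of the $\mathcal R(\underline I)$-module $\mathcal R(\mathcal F)$ with support in $\mathcal R_{++}$; it is $\mathbb Z^s$-graded and the subscript $\underline n$ denotes the degree $\underline n$ component. Hilbert function, polynomial, coefficients: $H_{\mathcal F}(\underline n)=\lambda(R/\mathcal F(\underline n))$; $P_{\mathcal F}$ is the polynomial of degree $d$ with $P_{\mathcal F}(\underline n)=H_{\mathcal F}(\underline n)$ for all large $\underline n$, written $$P_{\mathcal F}(\underline n)=\sum_{\alpha\in\mathbb N^s,\ |\alpha|\le d}(-1)^{d-|\alpha|}e_\alpha(\mathcal F)\binom{n_1+\alpha_1-1}{\alpha_1}\cdots\binom{n_s+\alpha_s-1}{\alpha_s},$$ with integers $e_\alpha(\mathcal F)$, the Hilbert coefficients. *)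

(* Defs.v *)
From HB Require Import structures.
From mathcomp Require Import all_boot all_order all_algebra.
From mathcomp Require Import mpoly.
From mathcomp Require Import boolp classical_sets functions cardinality fsbigop.

Set Implicit Arguments.
Unset Strict Implicit.
Unset Printing Implicit Defensive.

Import Order.TTheory GRing.Theory Num.Theory.

Local Open Scope classical_set_scope.
Local Open Scope ring_scope.

Section Ideals.
Context {R : comNzRingType}.
Implicit Types (I J K P M m : set R) (k : nat) (X : seq R).

Definition ideal J : Prop :=
  [/\ J 0, forall x y, J x -> J y -> J (x + y) & forall a x, J x -> J (a * x)].

Definition ideal_gen (S : set R) : set R := smallest ideal S.

Definition idealM I J : set R := ideal_gen [set x * y | x in I & y in J].

Definition idealX J k : set R := iter k (idealM J) setT.

Definition prime_ideal P : Prop :=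
  [/\ ideal P, ~ P 1 & forall x y, P (x * y) -> P x \/ P y].

Definition maximal_ideal M : Prop :=
  [/\ ideal M, M <> setT &
      forall J, ideal J -> M `<=` J -> J = M \/ J = setT].

Definition local_ring m : Prop :=
  maximal_ideal m /\ forall M, maximal_ideal M -> M = m.

Definition infinite_residue_field m : Prop :=
  infinite_set (range (fun x : R => [set y | m (y - x)])).

Definition radical J : set R := [set x | exists k, J (x ^+ k)].

Definition primary_ideal J : Prop :=
  [/\ ideal J, ~ J 1 & forall x y, J (x * y) -> J x \/ radical J y].

Definition is_primary_to m J : Prop := primary_ideal J /\ radical J = m.

End Ideals.

Definition noetherian (R : comNzRingType) : Prop :=
  forall J : set R, ideal J -> exists X : seq R, J = ideal_gen [set x | x \in X].

Definition is_max (Q : nat -> Prop) (k : nat) : Prop :=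
  Q k /\ forall j, Q j -> (j <= k)%N.

Definition has_chain (T : Type) (Q : set T -> Prop) (k : nat) : Prop :=
  exists c : nat -> set T,
    (forall i, (i <= k)%N -> Q (c i)) /\
    (forall i, (i < k)%N -> c i `<` c i.+1).

Definition krull_dim (R : comNzRingType) (d : nat) : Prop :=
  is_max (has_chain (@prime_ideal R)) d.

Section Depth.
Context {R : comNzRingType}.

Definition regular_sequence (X : seq R) : Prop :=
  (forall i, (i < size X)%N -> forall y,
     let J := ideal_gen [set x | x \in take i X] in J (X`_i * y) -> J y) /\
  ~ ideal_gen [set x | x \in X] 1.

Definition depth (m : set R) (k : nat) : Prop :=
  is_max (fun k => exists X : seq R,
    [/\ size X = k, forall x, x \in X -> m x & regular_sequence X]) k.

Definition cohen_macaulay_local (m : set R) (d : nat) : Prop :=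
  [/\ noetherian R, local_ring m, krull_dim R d & depth m d].

(* The submodules of R / J are the K / J for K an ideal containing J, so       *)
(* length_quot J k says that R / J has length k over R.                       *)
Definition length_quot (J : set R) (k : nat) : Prop :=
  is_max (has_chain (fun K => ideal K /\ J `<=` K)) k.

(* lambda(R / J); the value is 0 by convention when the length is infinite.   *)
Definition lambda_quot (J : set R) : nat := xget 0%N (length_quot J).

End Depth.

Section Multidegrees.
Context {s : nat}.

Definition Zs : zmodType := {ffun 'I_s -> int}.

Definition Zs_le (m n : Zs) : Prop := forall i, m i <= n i.

Definition Zs_pos (n : Zs) : Zs := [ffun i => Num.max (n i) 0].

Definition Zs_e : Zs := [ffun=> 1].

Definition Zs_mnm (a : 'X_{1..s}) : Zs := [ffun i => (a i)%:Z].

End Multidegrees.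
Arguments Zs s : clear implicits.

Section Filtrations.
Context {R : comNzRingType} {s : nat}.
Implicit Types I : 'I_s -> set R.

Definition ideals_pow I (n : Zs s) : set R :=
  \big[idealM/setT]_(i < s) idealX (I i) `|Num.max (n i) 0|%N.

Record filtration I := Filtration {
  fil :> Zs s -> set R;
  fil_ideal : forall n, ideal (fil n);
  fil_pow : forall n, ideals_pow I n `<=` fil n;
  fil_mul : forall n m, idealM (fil n) (fil m) `<=` fil (n + m);
  fil_le : forall n m, Zs_le n m -> fil m `<=` fil n
}.

(* A Laurent polynomial in t_1, ..., t_s over R is represented by its         *)
(* finitely supported family of coefficients Zs s -> R; laurent_mul is the    *)
(* product of Laurent polynomials.                                            *)
Definition laurent_mul (f g : Zs s -> R) : Zs s -> R :=
  fun n => \sum_(p \in [set: Zs s]) f p * g (n - p).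

(* R'(F), for any family F of subsets of R.                                   *)
Definition ext_rees (F : Zs s -> set R) : set (Zs s -> R) :=
  [set f | finite_set [set n | f n != 0] /\ forall n, F n (f n)].

Definition admissible I (F : filtration I) : Prop :=
  (forall n, F n = F (Zs_pos n)) /\
  exists k (g : 'I_k -> Zs s -> R), (forall j, ext_rees F (g j)) /\
    forall f, ext_rees F f -> exists a : 'I_k -> Zs s -> R,
      (forall j, ext_rees (ideals_pow I) (a j)) /\
      f = fun n => \sum_(j < k) laurent_mul (a j) (g j) n.

End Filtrations.

Section IdealTheory.
Context {R : comNzRingType} {s : nat}.
Implicit Types (I J K : set R) (II : 'I_s -> set R).

Lemma ideal_gen_ideal (S : set R) : ideal (ideal_gen S).
Proof.
split=> [K [[]]//|x y Jx Jy K KS|a x Jx K KS].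
- by case: (KS) => -[_ KD _] _; apply: KD; [apply: Jx|apply: Jy].
- by case: (KS) => -[_ _ KM] _; apply: KM; apply: Jx.
Qed.

Lemma idealT : ideal [set: R]. Proof. by []. Qed.

Lemma idealM_ideal I J : ideal (idealM I J).
Proof. exact: ideal_gen_ideal. Qed.

Lemma idealX_ideal I k : ideal (idealX I k).
Proof. by case: k => [|k]; [exact: idealT|exact: idealM_ideal]. Qed.

Lemma idealM_mul I J x y : I x -> J y -> idealM I J (x * y).
Proof. by move=> Ix Jy K [_]; apply; exists x => //; exists y. Qed.

Lemma idealM_sub I J K : ideal K ->
  (forall x y, I x -> J y -> K (x * y)) -> idealM I J `<=` K.
Proof. by move=> iK H z; apply; split=> // _ [x Ix [y Jy <-]]; exact: H. Qed.

Lemma ideal_colon K y : ideal K -> ideal [set x | K (x * y)].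
Proof.
case=> K0 KD KM; split=> [|x z|a x] /=; rewrite ?mul0r ?mulrDl -?mulrA //.
- exact: KD.
- exact: KM.
Qed.

Lemma idealM_mul4 I J I' J' x y :
  (forall u v, I u -> J v -> I' (u * v)) -> forall K L K',
  (forall u v, K u -> L v -> K' (u * v)) ->
  idealM I K x -> idealM J L y -> idealM I' K' (x * y).
Proof.
move=> HI K L K' HK Hx Hy.
have iM := idealM_ideal I' K'.
suff: idealM I K `<=` [set x | idealM I' K' (x * y)] by apply.
apply: idealM_sub; first exact: ideal_colon.
move=> u k Iu Kk /=; rewrite mulrC.
suff: idealM J L `<=` [set y | idealM I' K' (y * (u * k))] by apply.
apply: idealM_sub; first exact: ideal_colon.
move=> v l Jv Ll /=; rewrite mulrACA (mulrC v) (mulrC l).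
by apply: idealM_mul; [exact: HI|exact: HK].
Qed.

Lemma idealX_mul I j k x y :
  idealX I j x -> idealX I k y -> idealX I (j + k) (x * y).
Proof.
elim: j x => [|j IHj] x.
  by move=> _ Jy; rewrite add0n; case: (idealX_ideal I k) => _ _; apply.
rewrite addSn => Hx Hy.
have iM : ideal (idealX I (j + k).+1) by exact: idealX_ideal.
suff: idealX I j.+1 `<=` [set x | idealX I (j + k).+1 (x * y)] by apply.
apply: idealM_sub; first exact: ideal_colon.
by move=> u v Iu Iv /=; rewrite -mulrA; apply: idealM_mul => //; exact: IHj.
Qed.

Lemma ideals_pow_ideal II n : ideal (ideals_pow II n).
Proof.
rewrite /ideals_pow; elim/big_rec: _ => [|i K _ _]; first exact: idealT.
exact: idealM_ideal.
Qed.

Lemma ideals_pow_mul II (a b : 'X_{1..s}) x y :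
  ideals_pow II (Zs_mnm a) x -> ideals_pow II (Zs_mnm b) y ->
  ideals_pow II (Zs_mnm (a + b)%MM) (x * y).
Proof.
rewrite /ideals_pow.
move: x y; elim/big_rec3: _ => //= i A B C _ IH x y.
apply: idealM_mul4 => //.
move=> u v; rewrite !ffunE !(max_l (_ : 0 <= _%:Z)) // mnmDE.
exact: idealX_mul.
Qed.

Lemma ideals_pow0 II : ideals_pow II 0 = setT.
Proof.
rewrite /ideals_pow; elim/big_rec: _ => // i K _ ->; rewrite ffunE.
rewrite eqEsubset; split=> // x _; rewrite -[x]mulr1.
by apply: idealM_mul.
Qed.

Lemma Zs_mnmD (a b : 'X_{1..s}) : Zs_mnm (a + b)%MM = Zs_mnm a + Zs_mnm b.
Proof. by apply/ffunP=> i; rewrite !ffunE mnmDE. Qed.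

Lemma Zs_mnm0 : Zs_mnm (0%MM : 'X_{1..s}) = 0.
Proof. by apply/ffunP=> i; rewrite !ffunE mnm0E. Qed.

Lemma ideal_sum J (T : Type) (r : seq T) (Q : pred T) (f : T -> R) : ideal J ->
  (forall i, Q i -> J (f i)) -> J (\sum_(i <- r | Q i) f i).
Proof. by case=> J0 JD _ H; apply: big_ind. Qed.

Lemma ideal_mcoeffM J (p q : {mpoly R[s]}) m : ideal J ->
  (forall a b, m = (a + b)%MM -> J (p@_a * q@_b)) -> J (p * q)@_m.
Proof.
by move=> iJ H; rewrite mcoeffM; apply: ideal_sum => // k /eqP; apply: H.
Qed.

Lemma idealB J x y : ideal J -> J x -> J y -> J (x - y).
Proof. by case=> _ JD JM Jx Jy; apply: JD => //; rewrite -mulN1r; apply: JM. Qed.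

End IdealTheory.

Section GradedModules.
Context {s : nat} {A : comNzRingType} (gA : Zs s -> set A).

(* Zs-graded modules over the ring A graded by the components gA: the         *)
(* underlying module is the internal direct sum of the subgroups gcomp n.     *)
Record gmod := GMod {
  gcar :> lmodType A;
  gcomp : Zs s -> set gcar;
  gcomp0 : forall n, gcomp n 0;
  gcompB : forall n x y, gcomp n x -> gcomp n y -> gcomp n (x - y);
  gcompZ : forall p n a x, gA p a -> gcomp n x -> gcomp (p + n) (a *: x);
  gcomp_span : forall x, exists (r : seq (Zs s)) (f : Zs s -> gcar),
    (forall n, gcomp n (f n)) /\ x = \sum_(n <- r) f n;
  gcomp_free : forall (r : seq (Zs s)) (f : Zs s -> gcar), uniq r ->
    (forall n, gcomp n (f n)) -> \sum_(n <- r) f n = 0 ->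
    forall n, n \in r -> f n = 0
}.

Definition graded (M N : gmod) (f : {linear M -> N}) : Prop :=
  forall n x, gcomp n x -> gcomp n (f x).

Definition ginjective (E : gmod) : Prop :=
  forall (N P : gmod) (i : {linear N -> P}) (g : {linear N -> E}),
    graded i -> injective i -> graded g ->
    exists2 h : {linear P -> E}, graded h & forall x, h (i x) = g x.

Record injective_resolution (M : gmod) := InjectiveResolution {
  res :> nat -> gmod;
  res_inj : forall k, ginjective (res k);
  res_aug : {linear M -> res 0};
  res_d : forall k, {linear res k -> res k.+1};
  res_aug_graded : graded res_aug;
  res_d_graded : forall k, graded (res_d k);
  res_aug_inj : injective res_aug;
  res_exact0 : forall x, res_d 0 x = 0 <-> exists y, res_aug y = x;
  res_exact : forall k x, res_d k.+1 x = 0 <-> exists y, res_d k y = x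
}.

Definition torsion (J : set A) (M : gmod) : set M :=
  [set x | exists k, forall a, idealX J k a -> a *: x = 0].

Section LocalCohomology.
Context {M : gmod} (J : set A) (E : injective_resolution M).

Definition lc_cocycles i (n : Zs s) : set (E i) :=
  [set x | [/\ torsion J x, gcomp n x & res_d E i x = 0]].

Definition lc_coboundaries i (n : Zs s) : set (E i) :=
  match i with
  | 0%N => [set 0]
  | j.+1 => [set res_d E j y | y in [set y | torsion J y /\ gcomp n y]]
  end.

(* H^i_J(M)_n = 0.  Local cohomology, with its grading, is the right derived  *)
(* functor of J-torsion on graded modules: the degree n component of the i-th *)
(* cohomology of the J-torsion of a graded injective resolution E of M, the   *)
(* choice of which is immaterial.                                             *)
Definition lc_vanishes (i : nat) (n : Zs s) : Prop :=
  @lc_cocycles i n `<=` @lc_coboundaries i n.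

End LocalCohomology.
End GradedModules.

Section ReesRing.
Context {R : comNzRingType} {s : nat} (I : 'I_s -> set R).

Definition rees_pred : {pred {mpoly R[s]}} :=
  fun p => `[< forall m, ideals_pow I (Zs_mnm m) p@_m >].

Lemma rees_predP p :
  reflect (forall m, ideals_pow I (Zs_mnm m) p@_m) (p \in rees_pred).
Proof. exact: asboolP. Qed.

Lemma rees_pred_subring : subring_closed rees_pred.
Proof.
split=> [|p q /rees_predP Hp /rees_predP Hq|p q /rees_predP Hp /rees_predP Hq].
- apply/rees_predP => m; rewrite mcoeff1.
  have [->|_] := eqVneq; first by rewrite Zs_mnm0 ideals_pow0.
  by case: (ideals_pow_ideal I (Zs_mnm m)).
- apply/rees_predP => m; rewrite mcoeffB.
  by apply: idealB => //; apply: ideals_pow_ideal.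
- apply/rees_predP => m.
  apply: ideal_mcoeffM => [|a b ->]; first exact: ideals_pow_ideal.
  exact: ideals_pow_mul.
Qed.

HB.instance Definition _ :=
  GRing.isSubringClosed.Build {mpoly R[s]} rees_pred rees_pred_subring.

(* R(I), as a subring of R[t_1, ..., t_s]. *)
Record rees_ring :=
  ReesRing { rees_val :> {mpoly R[s]}; _ : rees_val \in rees_pred }.

HB.instance Definition _ := [isSub for rees_val].
HB.instance Definition _ := [Choice of rees_ring by <:].
HB.instance Definition _ := [SubChoice_isSubComNzRing of rees_ring by <:].

Definition rees_ring_comp (n : Zs s) : set rees_ring :=
  [set a | forall m, (a : {mpoly R[s]})@_m != 0 -> Zs_mnm m = n].

(* R_{++} *)
Definition rees_irrelevant : set rees_ring :=
  [set a | forall m, (a : {mpoly R[s]})@_m != 0 -> Zs_le Zs_e (Zs_mnm m)].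

Section ReesModule.
Context (F : filtration I).

Definition rees_mod_pred : {pred {mpoly R[s]}} :=
  fun p => `[< forall m, F (Zs_mnm m) p@_m >].

Lemma rees_mod_predP p :
  reflect (forall m, F (Zs_mnm m) p@_m) (p \in rees_mod_pred).
Proof. exact: asboolP. Qed.

Lemma rees_mod_pred_zmod : zmod_closed rees_mod_pred.
Proof.
split=> [|p q /rees_mod_predP Hp /rees_mod_predP Hq]; apply/rees_mod_predP => m.
- by rewrite mcoeff0; case: (fil_ideal F (Zs_mnm m)).
- by rewrite mcoeffB; apply: idealB => //; apply: fil_ideal.
Qed.

HB.instance Definition _ :=
  GRing.isZmodClosed.Build {mpoly R[s]} rees_mod_pred rees_mod_pred_zmod.

Lemma rees_mod_pred_scale (a : rees_ring) p :
  p \in rees_mod_pred -> (a : {mpoly R[s]}) * p \in rees_mod_pred.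
Proof.
case: a => a /= /rees_predP Ha /rees_mod_predP Hp; apply/rees_mod_predP => m.
apply: ideal_mcoeffM => [|b k ->]; first exact: fil_ideal.
rewrite Zs_mnmD; apply: fil_mul; apply: idealM_mul => //.
exact: fil_pow.
Qed.

(* R(F), as an R(I)-submodule of R[t_1, ..., t_s]. *)
Record rees_mod :=
  ReesMod { rees_mod_val :> {mpoly R[s]}; _ : rees_mod_val \in rees_mod_pred }.

HB.instance Definition _ := [isSub for rees_mod_val].
HB.instance Definition _ := [Choice of rees_mod by <:].
HB.instance Definition _ := [SubChoice_isSubZmodule of rees_mod by <:].

Definition rees_mod_scale (a : rees_ring) (x : rees_mod) : rees_mod :=
  ReesMod (rees_mod_pred_scale a (valP x)).

Lemma rees_mod_scaleA a b x :
  rees_mod_scale a (rees_mod_scale b x) = rees_mod_scale (a * b) x.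
Proof. by apply: val_inj; rewrite /= mulrA. Qed.

Lemma rees_mod_scale1 : left_id 1 rees_mod_scale.
Proof. by move=> x; apply: val_inj; rewrite /= mul1r. Qed.

Lemma rees_mod_scaleDr : right_distributive rees_mod_scale +%R.
Proof. by move=> a x y; apply: val_inj; rewrite /= mulrDr. Qed.

Lemma rees_mod_scaleDl x : {morph rees_mod_scale^~ x : a b / a + b}.
Proof. by move=> a b; apply: val_inj; rewrite /= mulrDl. Qed.

HB.instance Definition _ := GRing.Zmodule_isLmodule.Build rees_ring rees_mod
  rees_mod_scaleA rees_mod_scale1 rees_mod_scaleDr rees_mod_scaleDl.

Definition rees_mod_comp (n : Zs s) : set rees_mod :=
  [set x | forall m, (x : {mpoly R[s]})@_m != 0 -> Zs_mnm m = n].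

Lemma rees_mod_comp0 n : rees_mod_comp n 0.
Proof. by move=> m; rewrite mcoeff0 eqxx. Qed.

Lemma rees_mod_compB n x y :
  rees_mod_comp n x -> rees_mod_comp n y -> rees_mod_comp n (x - y).
Proof.
move=> Hx Hy m; rewrite mcoeffB.
have [x0|/Hx//] := eqVneq (x : {mpoly R[s]})@_m 0.
have [y0|/Hy//] := eqVneq (y : {mpoly R[s]})@_m 0.
by rewrite x0 y0 subr0 eqxx.
Qed.

Lemma rees_mod_compZ p n a x :
  rees_ring_comp p a -> rees_mod_comp n x -> rees_mod_comp (p + n) (a *: x).
Proof.
move=> Ha Hx m; apply: contra_neq_eq => /eqP nmn.
rewrite mcoeffM big1 // => k /eqP mk.
have [->|/Ha Ep] := eqVneq (a : {mpoly R[s]})@_k.1 0; first by rewrite mul0r.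
have [->|/Hx En] := eqVneq (x : {mpoly R[s]})@_k.2 0; first by rewrite mulr0.
by case: nmn; rewrite mk Zs_mnmD Ep En.
Qed.

Lemma rees_mod_term_subproof (p : rees_mod) m :
  (p : {mpoly R[s]})@_m *: 'X_[m] \in rees_mod_pred.
Proof.
apply/rees_mod_predP => k; rewrite mcoeffZ mcoeffX.
have [<-|_] := eqVneq.
  by rewrite mulr1; exact: (rees_mod_predP _ (valP p)).
by rewrite mulr0; case: (fil_ideal F (Zs_mnm k)).
Qed.

Definition rees_mod_term p m := ReesMod (rees_mod_term_subproof p m).

Lemma rees_mod_val_sum (T : Type) (r : seq T) (Q : pred T) (f : T -> rees_mod) :
  rees_mod_val (\sum_(i <- r | Q i) f i) = \sum_(i <- r | Q i) rees_mod_val (f i).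
Proof. by elim/big_rec2: _ => // i x y _ <-. Qed.

Lemma rees_mod_comp_span x : exists (r : seq (Zs s)) (f : Zs s -> rees_mod),
  (forall n, rees_mod_comp n (f n)) /\ x = \sum_(n <- r) f n.
Proof.
pose mo (n : Zs s) : 'X_{1..s} := [multinom `|n i|%N | i < s].
have moK m : mo (Zs_mnm m) = m by apply/mnmP => i; rewrite mnmE ffunE.
exists [seq Zs_mnm m | m <- msupp x].
exists (fun n => if Zs_mnm (mo n) == n then rees_mod_term x (mo n) else 0); split.
  move=> n; case: eqP => [E|_]; last exact: rees_mod_comp0.
  move=> m /=; rewrite mcoeffZ mcoeffX; have [<-//|_] := eqVneq (mo n) m.
  by rewrite mulr0 eqxx.
apply: val_inj; rewrite /= rees_mod_val_sum big_map [LHS]mpolyE.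
by apply: eq_bigr => m _; rewrite moK eqxx.
Qed.

Lemma rees_mod_comp_free (r : seq (Zs s)) (f : Zs s -> rees_mod) : uniq r ->
  (forall n, rees_mod_comp n (f n)) -> \sum_(n <- r) f n = 0 ->
  forall n, n \in r -> f n = 0.
Proof.
move=> ur Hf /(congr1 rees_mod_val); rewrite rees_mod_val_sum => S0 n nr.
apply: val_inj; apply/mpolyP => m; rewrite [RHS]mcoeff0.
have [//|/[dup] /Hf Em nz] := eqVneq (f n : {mpoly R[s]})@_m 0.
have := congr1 (mcoeff m) S0.
rewrite [RHS]mcoeff0 raddf_sum (bigD1_seq n) //= big1 ?addr0 // => k kn.
by apply/eqP; apply: contraNT kn => /Hf <-; rewrite Em.
Qed.

Definition rees_gmod : gmod rees_ring_comp :=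
  GMod rees_mod_comp0 rees_mod_compB rees_mod_compZ
    rees_mod_comp_span rees_mod_comp_free.

End ReesModule.
End ReesRing.

Arguments rees_irrelevant {R s} I.

Section Hilbert.
Context {R : comNzRingType} {s : nat}.

Definition hilbert_fun (F : Zs s -> set R) (n : Zs s) : nat := lambda_quot (F n).

Definition Zs_eval (P : {mpoly rat[s]}) (n : Zs s) : rat :=
  P.@[fun i => (n i)%:~R].

Definition hilbert_poly (F : Zs s -> set R) (d : nat) (P : {mpoly rat[s]}) : Prop :=
  msize P = d.+1 /\
  exists N : nat, forall n : Zs s, (forall i, N%:Z <= n i) ->
    Zs_eval P n = (hilbert_fun F n)%:R.

(* The polynomial binomial(X_i + a - 1, a) = X_i (X_i + 1) ... (X_i + a - 1) / a!. *)
Definition binom_poly (i : 'I_s) (a : nat) : {mpoly rat[s]} :=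
  (a`!%:R)^-1 *: \prod_(j < a) ('X_i + j%:R).

Definition hilbert_coefs (d : nat) (P : {mpoly rat[s]}) (e : 'X_{1..s} -> int) : Prop :=
  P = \sum_(al : 'X_{1..s < d.+1})
        ((-1) ^+ (d - mdeg al) * (e al)%:~R) *: \prod_(i < s) binom_poly i (al i).

End Hilbert.

(* Main.v *)
Require Import Defs.
From HB Require Import structures.
From mathcomp Require Import all_boot all_order all_algebra.
From mathcomp Require Import mpoly.
From mathcomp Require Import boolp classical_sets functions cardinality fsbigop.
From mathcomp Require Import ring zify.

(** Write [l] for length, [e_i] for the unit vectors and [H], [P] for the Hilbert
    function and polynomial of [F].

    Dimension one.  Let [J] be an ideal such that [R/J] has no socle, and suppose
    that [l(R/(F(n) + J))] agrees for large [n] with a linear form [L(n)]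
    without constant term.  Let [b] in [I_i] be superficial: for large [n],
    [b x] lies in [F(n + e_i) + J] only if [x] lies in [F(n) + J].  Additivity of
    length gives [L(e_i) = l(R/(F(n + e_i) + J + bR))] for large [n], which is
    [l(R/(J + bR))] by Krull's intersection theorem.  Since [b F(n)] lies in
    [F(n + e_i)] for every [n], the length never increases by more than [L(e_i)]
    from [n] to [n + e_i].  So [l(R/(F(n) + J)) - L(n)] is nonincreasing; it is
    zero for [n = 0], because [F(0) = R], and for large [n], hence everywhere
    ([linear_hilbert_fun]).  For [d = 1] the hypothesis [e_0 = 0] says that [P]
    is such a form, with [J = 0].

    Dimension two.  Let [a] in [I_i] be superficial for [J = 0].  For large [n],
    [l(R/(F(n) + aR)) = P(n) - P(n - e_i)], and the vanishing of the coefficients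
    [e_{e_j}] means that this is a linear form without constant term
    ([hilbert_diff_linear]).  By the first part, with [J = aR], the equality
    holds for all [n].  The vanishing of [H^1] makes each [F(n)] Ratliff-Rush
    closed ([ratliff_rush_closed]), so that [(F(n + e_i) : a) = F(n)] for all
    [n] in [N^s], and [H] and [P] have equal increments ([hilbert_increment]).
    As they agree for large [n], they agree on [N^s]; in degree [0] this reads
    [e_0 = H(0) = 0].

    Superficial elements ([superficial_exists]) are found by avoiding finitely
    many ideals ([ideal_avoidance]); the list comes from a noetherian induction
    over the homogeneous ideals of the Rees ring [R(F)]
    ([nonzerodivisor_large]), which is a finitely generated [R]-algebra
    ([graded_ideal_max]).  Quotients of [R] never appear: everything is stated
    for ideals of [R] modulo a fixed ideal [J]. *)

Set Implicit Arguments.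
Unset Strict Implicit.
Unset Printing Implicit Defensive.

Import Order.TTheory GRing.Theory Num.Theory.

Local Open Scope classical_set_scope.
Local Open Scope ring_scope.

(** * Ideals and the noetherian condition *)

Section IdealBasics.
Context {R : comNzRingType}.
Implicit Types (J K : set R) (b x y : R).

Definition idealD K J : set R := [set x | exists2 y, K y & J (x - y)].

Definition principal b : set R := [set b * r | r in setT].

Definition colon K b : set R := [set x | K (b * x)].

Lemma ideal_mulr K x y : ideal K -> K x -> K (x * y).
Proof. by case=> _ _ KM Kx; rewrite mulrC; apply: KM. Qed.

Lemma idealN K x : ideal K -> K x -> K (- x).
Proof. by case=> _ _ KM Kx; rewrite -mulN1r; apply: KM. Qed.

Lemma ideal_subK K x y : ideal K -> K (x - y) -> K y -> K x.
Proof. by case=> _ KD _ Kxy Ky; rewrite -(subrK y x); apply: KD. Qed.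

Lemma ideal_subKr K x y : ideal K -> K (x - y) -> K x -> K y.
Proof.
move=> iK Kxy Kx; have := idealB iK Kx Kxy.
by rewrite opprB addrCA subrr addr0.
Qed.

Lemma ideal_eqT K : ideal K -> K 1 -> K = setT.
Proof.
case=> _ _ KM K1; rewrite eqEsubset; split=> // x _.
by rewrite -[x]mulr1; apply: KM.
Qed.

Lemma idealD_ideal K J : ideal K -> ideal J -> ideal (idealD K J).
Proof.
move=> [K0 KD KM] [J0 JD JM]; split.
- by exists 0; rewrite ?subr0.
- move=> x y [x' Kx Jx] [y' Ky Jy]; exists (x' + y'); first exact: KD.
  by rewrite opprD addrACA; apply: JD.
- by move=> a x [y Ky Jy]; exists (a * y); [exact: KM|rewrite -mulrBr; exact: JM].
Qed.

Lemma idealD_l K J x : ideal J -> K x -> idealD K J x.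
Proof. by case=> J0 _ _ Kx; exists x => //; rewrite subrr. Qed.

Lemma idealD_r K J x : ideal K -> J x -> idealD K J x.
Proof. by case=> K0 _ _ Jx; exists 0; rewrite ?subr0. Qed.

Lemma idealDS K K' J : K `<=` K' -> idealD K J `<=` idealD K' J.
Proof. by move=> KK' x [y /KK' Ky Jxy]; exists y. Qed.

Lemma idealD_sub K J L : ideal L -> K `<=` L -> J `<=` L -> idealD K J `<=` L.
Proof. by move=> iL KL JL x [y /KL Ly /JL Lxy]; apply: ideal_subK Ly. Qed.

Lemma idealD_idem K J x y :
  ideal J -> J (x - y) -> idealD K J y -> idealD K J x.
Proof.
move=> [_ JD _] Jxy [z Kz Jyz]; exists z => //.
by rewrite -(subrKA y); apply: JD.
Qed.

Lemma idealD0 K : idealD K [set 0] = K.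
Proof.
rewrite eqEsubset; split=> x; first by case=> y Ky /= /subr0_eq ->.
by move=> Kx; exists x => //=; rewrite subrr.
Qed.

Lemma ideal0 : ideal [set (0 : R)].
Proof.
by split=> [//|x y /= -> ->|a x /= ->]; rewrite ?addr0 ?mulr0.
Qed.

Lemma principal_ideal b : ideal (principal b).
Proof.
split=> [|_ _ [x _ <-] [y _ <-]|a _ [x _ <-]].
- by exists 0; rewrite ?mulr0.
- by exists (x + y); rewrite ?mulrDr.
- by exists (a * x) => //; ring.
Qed.

Lemma principal_id b : principal b b.
Proof. by exists 1; rewrite ?mulr1. Qed.

Lemma colon_ideal K b : ideal K -> ideal (colon K b).
Proof.
case=> K0 KD KM; split=> [|x y|a x]; rewrite /colon /= ?mulr0 ?mulrDr //.
  exact: KD.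
by move=> Kx; rewrite mulrCA; apply: KM.
Qed.

Lemma idealX_expr K k x : K x -> idealX K k (x ^+ k).
Proof.
move=> Kx; elim: k => [|k IH]; first by rewrite expr0.
by rewrite exprS; apply: idealM_mul.
Qed.

Lemma ideal_gen_sub K (S : set R) : ideal K -> S `<=` K -> ideal_gen S `<=` K.
Proof. by move=> iK SK x; apply. Qed.

Lemma ideal_gen_mem (S : set R) : S `<=` ideal_gen S.
Proof. by move=> x Sx K [_]; apply. Qed.

End IdealBasics.

Section Noetherian.

(** Without a maximal element, dependent choice gives an ascending chain of
    ideals; finitely many generators of its union already lie in one term. *)
Lemma noetherian_max (R : comNzRingType) (C : set R -> Prop) :
  noetherian R -> (exists K, C K) -> (forall K, C K -> ideal K) ->
  exists2 K, C K & forall K', C K' -> K `<=` K' -> K' `<=` K.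
Proof.
move=> nR [K0 CK0] Ci; apply: contrapT => nomax.
have next K : exists K', C K -> [/\ C K', K `<=` K' & ~ K' `<=` K].
  have [CK|//] := pselect (C K); last by exists K.
  apply: contrapT => H; apply: nomax; exists K => // K' CK' KK'.
  by apply: contrapT => H'; apply: H; exists K'.
have [f Hf] := choice next.
pose c k := iter k f K0.
have Cc k : C (c k) by elim: k => //= k /Hf [].
have cS k : c k `<=` c k.+1 by case: (Hf _ (Cc k)).
have cM j k : (j <= k)%N -> c j `<=` c k.
  elim: k => [|k IH]; first by rewrite leqn0 => /eqP ->.
  rewrite leq_eqVlt ltnS => /predU1P [-> //|/IH H]; exact: subset_trans (cS k).
pose U : set R := [set x | exists k, c k x].
have iU : ideal U.
  split; first by exists 0%N; case: (Ci _ (Cc 0%N)).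
    move=> x y [j cx] [k cy]; exists (maxn j k).
    have [_ D _] := Ci _ (Cc (maxn j k)).
    by apply: D; [apply: cM cx; exact: leq_maxl|apply: cM cy; exact: leq_maxr].
  by move=> a x [k cx]; exists k; have [_ _] := Ci _ (Cc k); apply.
have [X UX] := nR U iU.
have [k Xk] : exists k, forall x, x \in X -> c k x.
  have : forall x, x \in X -> U x by move=> x xX; rewrite UX; apply: ideal_gen_mem.
  elim: X {UX} => [|x X IH] H; first by exists 0%N.
  have [k Hk] := IH (fun y yX => H y (mem_behead (s := x :: X) yX)).
  have [j Hj] := H x (mem_head _ _).
  exists (maxn j k) => y; rewrite inE => /predU1P [->|yX].
    by apply: cM Hj; exact: leq_maxl.
  by apply: cM (Hk _ yX); exact: leq_maxr.
have [_ _] := Hf _ (Cc k); apply => x ckx.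
have: U x by exists k.+1.
by rewrite UX; apply: ideal_gen_sub; [exact: Ci|exact: Xk].
Qed.

(** Hilbert's basis theorem.  The [k]-th coefficients of the members of [A] of
    degree at most [k] form an ascending chain [L k] of ideals, stationary from
    [N] on; lifting generators of [L 0], ..., [L N] gives generators of [A],
    since they suffice to cancel any leading term. *)
Lemma noetherian_poly (R : comNzRingType) : noetherian R -> noetherian {poly R}.
Proof.
move=> nR A iA; have [A0 AD AM] := iA.
pose L k : set R := [set c | exists p, [/\ A p, (size p <= k.+1)%N & p`_k = c]].
have lowideal (B : set {poly R}) k : ideal B ->
    ideal [set c | exists p, [/\ B p, (size p <= k.+1)%N & p`_k = c]].
  case=> B0 BD BM; split.
  - by exists 0; rewrite size_poly0 coef0.
  - move=> _ _ [p [Bp sp <-]] [q [Bq sq <-]]; exists (p + q); split.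
    + exact: BD.
    + by rewrite (leq_trans (size_polyD _ _)) // geq_max sp.
    + by rewrite coefD.
  - move=> a _ [p [Bp sp <-]]; exists (a%:P * p); split; first exact: BM.
      rewrite mul_polyC; exact: leq_trans (size_scale_leq _ _) sp.
    by rewrite coefCM.
have iL k : ideal (L k) by exact: lowideal.
have LM j k : (j <= k)%N -> L j `<=` L k.
  move=> jk _ [p [Ap sp <-]]; exists ('X^(k - j) * p); split; first exact: AM.
    rewrite mulrC; have [->|p0] := eqVneq p 0; first by rewrite mul0r size_poly0.
    by rewrite size_mulXn //; lia.
  by rewrite coefXnM; case: ltnP => [|_]; [lia|congr (_`__); lia].
have [_ [N <-] maxN] : exists2 K, (exists k, L k = K) & forall K',
    (exists k, L k = K') -> K `<=` K' -> K' `<=` K.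
  by apply: (noetherian_max nR); [exists (L 0%N), 0%N|move=> _ [k <-]].
have gens k : exists S : seq {poly R}, (forall p, p \in S -> A p) /\
    L k `<=` [set c | exists p,
      [/\ ideal_gen [set x | x \in S] p, (size p <= k.+1)%N & p`_k = c]].
  have [X LX] := nR _ (iL k).
  have lift (x : R) : exists p : {poly R},
      x \in X -> [/\ A p, (size p <= k.+1)%N & p`_k = x].
    have [xX|_] := boolP (x \in X); last by exists 0.
    have : L k x by rewrite LX; apply: ideal_gen_mem.
    by case=> p Hp; exists p.
  have [g Hg] := choice lift.
  exists (map g X); split; first by move=> _ /mapP [x /Hg [Ax _ _] ->].
  rewrite LX; apply: ideal_gen_sub.
    by apply: lowideal; exact: ideal_gen_ideal.
  move=> x /= xX; have [_ sx gx] := Hg _ xX.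
  by exists (g x); split=> //; apply: ideal_gen_mem; exact: map_f.
have [S HS] := choice gens.
exists (flatten [seq S k | k <- iota 0 N.+1]).
set Y := flatten _; set GY := ideal_gen _.
have iGY : ideal GY by exact: ideal_gen_ideal.
have YA : GY `<=` A.
  apply: ideal_gen_sub => // p /= /flatten_mapP [k _ pS].
  by have [H _] := HS k; exact: H.
rewrite eqEsubset; split=> // p.
have [n] := ubnP (size p); elim: n p => // n IH p sp Ap.
have [->|p0] := eqVneq p 0; first by case: iGY.
have psz : size p = (size p).-1.+1 by rewrite prednK // size_poly_gt0.
set k := (size p).-1 in psz.
pose j := minn k N.
have : L j p`_k.
  have Lk : L k p`_k by exists p; split=> //; rewrite psz.
  rewrite /j; case: (leqP k N) => // /ltnW Nk.
  by apply: (maxN (L k)) => //; [exists k|exact: LM].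
have [_ HSj] := HS j; move/HSj => [q [Gq sq qj]].
have GYq : GY q.
  move: (Gq); apply: ideal_gen_sub => // x /= xS; apply: ideal_gen_mem => /=.
  apply/flatten_mapP; exists j => //; rewrite mem_iota add0n ltnS.
  exact: geq_minr.
have jk : (j <= k)%N by exact: geq_minl.
have GYr : GY ('X^(k - j) * q) by case: iGY => _ _; apply.
apply: (ideal_subK iGY _ GYr); apply: IH; last first.
  by apply: idealB => //; exact: YA.
apply: (@leq_trans k.+1); last by rewrite -psz.
rewrite ltnS; apply/leq_sizeP => i ki; rewrite coefB coefXnM.
have -> : (i < k - j)%N = false by lia.
move: ki; rewrite leq_eqVlt => /predU1P [<-|ki].
  by rewrite subKn // qj subrr.
by rewrite !nth_default ?subr0 ?psz //; apply: leq_trans sq _; lia.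
Qed.

(** Adjoining one element at a time, a finitely generated algebra is an image
    of an iterated polynomial ring, hence inherits its chain conditions. *)
Lemma fg_algebra_cover (R C : comNzRingType) (phi : {rmorphism R -> C})
    (l : seq C) : noetherian R ->
  exists (D : comNzRingType) (psi : {rmorphism D -> C}),
  [/\ noetherian D, forall r, exists d, psi d = phi r,
      forall c, c \in l -> exists d, psi d = c &
      forall B : set C, (forall x y, B x -> B y -> B (x + y)) ->
        (forall x y, B x -> B y -> B (x * y)) ->
        (forall r, B (phi r)) -> (forall c, c \in l -> B c) ->
        forall d, B (psi d)].
Proof.
move=> nR; elim: l => [|c l [D [psi [nD imR iml imB]]]].
  by exists R, phi; split=> // r; exists r.
have cc : commr_rmorph psi c by move=> x; exact: mulrC.
exists {poly D}, (horner_morph cc); split.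
- exact: noetherian_poly.
- by move=> r; have [d <-] := imR r; exists d%:P; rewrite /= horner_morphC.
- move=> x; rewrite inE => /predU1P [->|/iml [d <-]].
    by exists 'X; rewrite /= horner_morphX.
  by exists d%:P; rewrite /= horner_morphC.
- move=> B BD BM BR Bl.
  have Bpsi d : B (psi d) by apply: imB => // x xl; apply: Bl; rewrite inE xl orbT.
  have Bc : B c by apply: Bl; rewrite mem_head.
  elim/poly_ind => [|p d IH]; first by rewrite rmorph0 -(rmorph0 phi).
  rewrite rmorphD rmorphM /= horner_morphX horner_morphC.
  by apply: BD => //; apply: BM.
Qed.

End Noetherian.

(** * Lengths of cyclic modules *)

Section Length.
Context {R : comNzRingType}.
Implicit Types (J K L A B : set R) (b x y : R).

Definition above K L : Prop := ideal L /\ K `<=` L.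

(** Chains built from the bottom and remembering their top term, so that they
    can be extended and compared by induction. *)
Inductive chain_to K : nat -> set R -> Prop :=
| Chain0 A : above K A -> chain_to K 0 A
| ChainS k A B : chain_to K k A -> above K B -> A `<` B -> chain_to K k.+1 B.

Definition finite_length K : Prop := exists n, forall k A, chain_to K k A -> (k <= n)%N.

Lemma chain_toP K k : has_chain (above K) k <-> exists A, chain_to K k A.
Proof.
split=> [[c [Qc Sc]]|[A]].
  exists (c k); have: (k <= k)%N by [].
  elim: {-2}k => [|j IH] jk; first by apply: Chain0; exact: Qc.
  by apply: (ChainS (IH (ltnW jk))); [exact: Qc|exact: Sc].
move=> H; suff [c [Qc [Sc _]]] : exists c : nat -> set R,
    (forall i, (i <= k)%N -> above K (c i)) /\
    (forall i, (i < k)%N -> c i `<` c i.+1) /\ c k = A by exists c.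
elim: H => {k A} [A QA|k A B _ [c [Qc [Sc ck]]] QB AB].
  by exists (fun=> A).
exists (fun i => if (i <= k)%N then c i else B); split; [|split].
- by move=> i _; case: ifP => // /Qc.
- move=> i; rewrite leq_eqVlt => /predU1P [[->]|].
    by rewrite leqnn ltnn ck.
  by rewrite ltnS => ik; rewrite (ltnW ik) ik; exact: Sc.
- by rewrite ltnn.
Qed.

Lemma lambda_quotP K : finite_length K ->
  (exists A, chain_to K (lambda_quot K) A) /\
  (forall k A, chain_to K k A -> (k <= lambda_quot K)%N).
Proof.
move=> [n Hn].
have ex0 : exists k, `[< exists A, chain_to K k A >].
  by exists 0%N; apply/asboolP; exists setT; apply: Chain0; split.
have ub k : `[< exists A, chain_to K k A >] -> (k <= n)%N.
  by move=> /asboolP [A /Hn].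
have [k /asboolP kA kmax] := ex_maxnP ex0 ub.
have Lk : length_quot K k.
  split; first by apply/chain_toP.
  by move=> j /chain_toP jA; apply: kmax; apply/asboolP.
suff : length_quot K (lambda_quot K).
  case=> /chain_toP ? H; split=> // j A jA; apply: H.
  by apply/chain_toP; exists A.
exact: (xgetPex 0%N (ex_intro _ k Lk)).
Qed.

Lemma lambda_quot_eq K k : (exists A, chain_to K k A) ->
  (forall j A, chain_to K j A -> (j <= k)%N) -> lambda_quot K = k.
Proof.
move=> [A kA] H.
have [[B lB] max] := lambda_quotP (ex_intro _ k H).
by apply/eqP; rewrite eqn_leq (H _ _ lB) (max _ _ kA).
Qed.

Lemma above_trans K K' L : K `<=` K' -> above K' L -> above K L.
Proof. by move=> KK' [iL K'L]; split=> //; exact: subset_trans K'L. Qed.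

Lemma chain_to_above K k A : chain_to K k A -> above K A.
Proof. by case. Qed.

Lemma chain_toW K k A B : chain_to K k A -> above K B -> A `<=` B ->
  chain_to K k B.
Proof.
move=> H; elim: H => {k A} [A _|k A A' kA _ _ AA'] QB AB; first exact: Chain0.
have [sAA' nA'A] := AA'; apply: ChainS kA QB _.
by split; [exact: subset_trans AB|move=> BA; apply: nA'A; exact: subset_trans BA].
Qed.

Lemma chain_to_sub K K' k A : K `<=` K' -> chain_to K' k A -> chain_to K k A.
Proof.
move=> KK'; elim=> {k A} [A QA|k A B _ IH QB AB].
  by apply: Chain0; exact: above_trans QA.
by apply: ChainS IH _ AB; exact: above_trans QB.
Qed.

Lemma finite_lengthS K K' : K `<=` K' -> finite_length K -> finite_length K'.
Proof. by move=> KK' [n Hn]; exists n => k A /(chain_to_sub KK') /Hn. Qed.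

Lemma lambda_quotS K K' : finite_length K -> K `<=` K' ->
  (lambda_quot K' <= lambda_quot K)%N.
Proof.
move=> fK KK'; have [_ max] := lambda_quotP fK.
have [[A H] _] := lambda_quotP (finite_lengthS KK' fK).
exact: max (chain_to_sub KK' H).
Qed.

Lemma chain_to_cat K L j k A B : K `<=` L -> chain_to K j A -> A `<=` L ->
  chain_to L k B -> chain_to K (j + k) B.
Proof.
move=> KL jA AL; elim=> {k B} [B [iB LB]|k B B' _ IH QB' BB'].
  by rewrite addn0; apply: chain_toW jA _ _; [split=> //|]; exact: subset_trans LB.
by rewrite addnS; apply: ChainS IH _ BB'; exact: above_trans QB'.
Qed.

Lemma lambda_quot_eqS K K' : ideal K -> finite_length K -> K `<=` K' ->
  lambda_quot K' = lambda_quot K -> K' `<=` K.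
Proof.
move=> iK fK KK' E; apply: contrapT => nK'K.
have [[A H] _] := lambda_quotP (finite_lengthS KK' fK).
have [_ max] := lambda_quotP fK.
suff: chain_to K (lambda_quot K').+1 A by move/max; rewrite E ltnn.
elim: H => {E} [B [iB K'B]|k B B' _ IH QB' BB'].
  apply: (@ChainS _ _ K); first by apply: Chain0; split.
    by split=> //; exact: subset_trans K'B.
  by split; [exact: subset_trans K'B|move=> BK; apply: nK'K; exact: subset_trans BK].
by apply: ChainS IH _ BB'; exact: above_trans QB'.
Qed.

(** Modular law: a step [A < B] of a chain above [K] stays strict in at least
    one of [(A : b) <= (B : b)] and [A + bR <= B + bR], so that a chain of
    [R/K] is split between [bR/(K & bR)] and [R/(K + bR)]. *)
Lemma chain_to_split K b k A : ideal K -> chain_to K k A ->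
  exists p q, [/\ (k <= p + q)%N, chain_to (colon K b) p (colon A b) &
    chain_to (idealD K (principal b)) q (idealD A (principal b))].
Proof.
move=> iK; have ib := principal_ideal b.
have Qc B : above K B -> above (colon K b) (colon B b).
  by case=> iB KB; split; [exact: colon_ideal|move=> x /KB].
have Qd B : above K B ->
    above (idealD K (principal b)) (idealD B (principal b)).
  by case=> iB KB; split; [exact: idealD_ideal|exact: idealDS].
elim=> {k A} [A QA|k A B kA [p [q [kpq pA qA]]] QB [AB nBA]].
  by exists 0%N, 0%N; split=> //; apply: Chain0; [exact: Qc|exact: Qd].
have [iA _] := chain_to_above kA; have [iB _] := QB.
have cAB : colon A b `<=` colon B b by move=> x /AB.
have dAB := idealDS (J := principal b) AB.
have [cBA|ncBA] := pselect (colon B b `<=` colon A b); last first.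
  exists p.+1, q; split; first by rewrite addSn ltnS.
    by apply: (ChainS pA); [exact: Qc|split].
  by apply: (chain_toW qA); [exact: Qd|].
have [dBA|ndBA] := pselect
    (idealD B (principal b) `<=` idealD A (principal b)); last first.
  exists p, q.+1; split; first by rewrite addnS ltnS.
    by apply: (chain_toW pA); [exact: Qc|].
  by apply: (ChainS qA); [exact: Qd|split].
case: nBA => x Bx.
have [y Ay [r _ Er]] := dBA _ (idealD_l ib Bx).
have Exy : x - y = b * r by rewrite Er.
apply: (ideal_subK iA _ Ay); rewrite Exy; apply: cBA; rewrite /colon /= -Exy.
by apply: idealB => //; exact: AB.
Qed.

Lemma chain_to_image K b k A : ideal K -> chain_to (colon K b) k A ->
  exists2 B, chain_to K k B &
    A = colon B b /\ B `<=` idealD K (principal b).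
Proof.
move=> iK H; have [K0 _ _] := iK.
pose im (L : set R) : set R := idealD [set b * x | x in L] K.
suff [iA ? ?] : [/\ ideal A, chain_to K k (im A) & A = colon (im A) b].
  exists (im A) => //; split=> // x [_ [r _ <-] Kx].
  by exists (x - b * r) => //; exists r => //; rewrite subKr.
have im_ideal L : ideal L -> ideal (im L).
  move=> iL; apply: idealD_ideal => //; case: iL => L0 LD LM; split.
  - by exists 0; rewrite ?mulr0.
  - by move=> _ _ [x Lx <-] [y Ly <-]; exists (x + y); rewrite ?mulrDr //; exact: LD.
  - by move=> a _ [x Lx <-]; exists (a * x); [exact: LM|rewrite mulrCA].
have colon_im L : above (colon K b) L -> L = colon (im L) b.
  move=> [iL KL]; rewrite eqEsubset; split=> x.
    by move=> Lx; apply: idealD_l => //; exists x.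
  case=> _ [y Ly <-]; rewrite -mulrBr => Kxy.
  by apply: (ideal_subK iL _ Ly); exact: KL.
have Qim L : above (colon K b) L -> above K (im L).
  move=> [iL KL]; split; first exact: im_ideal.
  move=> x Kx; exists 0; last by rewrite subr0.
  by exists 0; rewrite ?mulr0 //; case: iL.
elim: H => {k A} [A QA|k A B _ [iA kA EA] QB [AB nBA]].
  split; [by case: QA|by apply: Chain0; exact: Qim|exact: colon_im].
split; [by case: QB| |exact: colon_im].
apply: (ChainS kA); first exact: Qim.
split; first by apply: idealDS => _ [x /AB Bx <-]; exists x.
by move=> H; apply: nBA; rewrite EA (colon_im B QB) => x; exact: H.
Qed.

(** Additivity of length along [0 -> R/(K : b) -> R/K -> R/(K + bR) -> 0]. *)
Lemma lambda_quot_colon K b : ideal K -> finite_length (colon K b) ->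
  finite_length (idealD K (principal b)) ->
  finite_length K /\
  lambda_quot K = (lambda_quot (colon K b) +
                   lambda_quot (idealD K (principal b)))%N.
Proof.
move=> iK fc fd.
have [[A HA] Amax] := lambda_quotP fc; have [[B HB] Bmax] := lambda_quotP fd.
have ub j C : chain_to K j C -> (j <= lambda_quot (colon K b) +
    lambda_quot (idealD K (principal b)))%N.
  move=> /(chain_to_split b iK) [p [q [jpq /Amax pA /Bmax qB]]].
  exact: leq_trans jpq (leq_add pA qB).
split; first by eexists; exact: ub.
apply: (lambda_quot_eq _ ub); exists B.
have [A' HA' [_ A'd]] := chain_to_image iK HA.
apply: (chain_to_cat _ HA' A'd HB).
by move=> x; exact: idealD_l (principal_ideal b).
Qed.

Lemma chain_to1 K k A : K 1 -> chain_to K k A -> k = 0%N.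
Proof.
move=> K1 [//|j B C /chain_to_above [iB KB] [iC KC] [_ []]].
by rewrite (ideal_eqT iB (KB _ K1)).
Qed.

Lemma finite_length1 K : K 1 -> finite_length K.
Proof. by move=> K1; exists 0%N => k A /(chain_to1 K1) ->. Qed.

Lemma lambda_quot1 K : K 1 -> lambda_quot K = 0%N.
Proof.
move=> K1; apply: lambda_quot_eq => [|k A /(chain_to1 K1) -> //].
by exists setT; apply: Chain0; split.
Qed.

End Length.

Section Local.
Context {R : comNzRingType} (m : set R).
Hypotheses (nR : noetherian R) (locm : local_ring m).
Implicit Types (J K L : set R) (b x y : R).

Lemma local_ideal : ideal m. Proof. by case: locm => -[]. Qed.

Lemma local_proper : ~ m 1.
Proof. by case: locm => -[im mT _] _ /(ideal_eqT im). Qed.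

Lemma local_unit x : ~ m x -> exists y, x * y = 1.
Proof.
move=> nmx; apply: contrapT => nu.
have px : ~ principal x 1 by case=> y _ E; apply: nu; exists y.
have [M [[iM xM] nM1] maxM] := noetherian_max nR
  (C := fun K => above (principal x) K /\ ~ K 1)
  (ex_intro _ _ (conj (conj (principal_ideal x) (@subset_refl _ _)) px))
  (fun K H => proj1 (proj1 H)).
suff MM : maximal_ideal M.
  by apply: nmx; rewrite -(proj2 locm _ MM); apply: xM; exact: principal_id.
split=> // [MT|J iJ MJ]; first by apply: nM1; rewrite MT.
have [J1|nJ1] := pselect (J 1); first by right; exact: ideal_eqT.
left; rewrite eqEsubset; split=> //; apply: maxM => //.
by split=> //; split=> //; exact: subset_trans MJ.
Qed.

Lemma local_cancel J w x : ideal J -> m w -> J ((1 - w) * x) -> J x.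
Proof.
move=> iJ mw Jx; have [u Eu] : exists u, (1 - w) * u = 1.
  apply: local_unit => m1w; apply: local_proper.
  exact: ideal_subK local_ideal m1w mw.
by rewrite -[x]mul1r -Eu mulrAC; exact: ideal_mulr.
Qed.

Definition nilpotent_mod K : Prop := forall y, m y -> exists k, K (y ^+ k).

Lemma nilpotent_modS K K' : K `<=` K' -> nilpotent_mod K -> nilpotent_mod K'.
Proof. by move=> KK' nK y /nK [k /KK' ?]; exists k. Qed.

(** A maximal annihilator [(K : r)] of a nonzero element of [R/K] is [m]: for
    [y] in [m] with [r y] nonzero, maximality gives [(K : r y) = (K : r)], and
    so no power of [y] kills [r]. *)
Lemma socle_exists K : ideal K -> ~ K 1 -> nilpotent_mod K ->
  exists2 r, ~ K r & forall y, m y -> K (y * r).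
Proof.
move=> iK nK1 nilK.
have [_ [r nKr <-] maxr] := noetherian_max nR
  (C := fun L => exists2 r, ~ K r & colon K r = L)
  (ex_intro _ _ (ex_intro2 _ _ 1 nK1 erefl))
  (fun L '(ex_intro2 r _ E) => eq_ind _ ideal (colon_ideal r iK) _ E).
exists r => // y my; apply: contrapT => nKyr.
have sub : colon K (y * r) `<=` colon K r.
  apply: maxr; first by exists (y * r).
  by move=> x; rewrite /colon /= -mulrA; case: iK => _ _; apply.
have nKp j : ~ K (r * y ^+ j).
  elim: j => [|j IH]; first by rewrite expr0 mulr1.
  by rewrite exprS mulrA (mulrC r) => /sub.
by have [k Kk] := nilK y my; case: (nKp k); case: iK => _ _; apply.
Qed.

(** Noetherian induction: adding a socle element [r] to a maximal
    counterexample [K] changes the length by that of [R/m]. *)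
Lemma nilpotent_mod_finite_length K : ideal K -> nilpotent_mod K ->
  finite_length K.
Proof.
move=> iK nilK; apply: contrapT => nfK.
have [L [iL nilL nfL] maxL] := noetherian_max nR
  (C := fun L => [/\ ideal L, nilpotent_mod L & ~ finite_length L])
  (ex_intro _ K (And3 iK nilK nfK)) (fun L '(And3 iL _ _) => iL).
have nL1 : ~ L 1 by move/finite_length1.
have [r nLr Lr] := socle_exists iL nL1 nilL.
have ir := principal_ideal r.
have [[im _ maxm] _] := locm.
apply: nfL; apply: (proj1 (lambda_quot_colon (b := r) iL _ _)).
  apply: (@finite_lengthS _ m); first by move=> y /Lr; rewrite mulrC.
  suff H k A : chain_to m k A -> k = 0%N \/ k = 1%N /\ A = setT.
    by exists 1%N => k A /H [->|[->]].
  elim=> {k A} [A _|k A B /chain_to_above [iA mA] [->|[-> ->]] [iB mB] [AB nBA]].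
  - by left.
  - right; split=> //; have [E|//] := maxm B iB mB.
    by case: nBA; rewrite E.
  - by case: nBA.
apply: contrapT => nf; apply: nLr.
apply: (maxL (idealD L (principal r))).
- split=> //; first exact: idealD_ideal.
  by apply: nilpotent_modS nilL => x; exact: idealD_l.
- by move=> x; exact: idealD_l.
- by apply: idealD_r => //; exact: principal_id.
Qed.

(** Take [u] in [J] avoiding all the ideals but the first, [W]; if [u] lies in
    [W], choose [v] in [J] outside [W].  No [v + l u] lies in [W].  As the residue
    field is infinite, if each [v + l u] belonged to one of the other ideals,
    then two with [l - l'] a unit would belong to the same one, and so would
    [u]. *)
Lemma ideal_avoidance J (Ws : seq (set R)) : infinite_residue_field m ->
  ideal J -> (forall i, (i < size Ws)%N ->
    ideal (nth setT Ws i) /\ ~ J `<=` nth setT Ws i) ->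
  exists2 a, J a & forall i, (i < size Ws)%N -> ~ nth setT Ws i a.
Proof.
move=> infm iJ; have [J0 JD JM] := iJ.
have [l Hl] : exists l : nat -> R, forall i j, i <> j -> ~ m (l i - l j).
  move: infm => /infiniteP /pcard_leP [f].
  have lift k : exists x : R, [set y | m (y - x)] = f k.
    have [x _ E] : range (fun x => [set y | m (y - x)]) (f k) by exact: funS.
    by exists x.
  have [l El] := choice lift; exists l => i j ij mij; apply: ij.
  suff: f i = f j by move/(inj (f := f)); apply; rewrite inE.
  rewrite -!El eqEsubset.
  have im := local_ideal.
  split=> x /= mx.
  - by have [_ D _] := im; have := D _ _ mx mij; rewrite subrKA.
  - by have := idealB im mx mij; rewrite opprB subrKA.
elim: Ws => [|W Ws IH] HW; first by exists 0.
have [u Ju nu] := IH (fun i => HW i.+1).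
have [Wu|nWu] := pselect (W u); last by exists u => // -[].
have [iW nJW] := HW 0%N isT.
have [v Jv nWv] : exists2 v, J v & ~ W v.
  apply: contrapT => H; apply: nJW => v Jv.
  by apply: contrapT => nWv; apply: H; exists v.
pose w k := v + l k * u.
have Jw k : J (w k) by apply: JD => //; exact: JM.
have nWw k : ~ W (w k).
  move=> Wk; apply: nWv; rewrite -(addrK (l k * u) v); apply: idealB => //.
  by case: iW => _ _; apply.
apply: contrapT => none.
have sel (k : 'I_(size Ws).+1) : exists i : 'I_(size Ws), nth setT Ws i (w k).
  apply: contrapT => H; apply: none; exists (w k) => // -[|i] //= ilt Wi.
  by apply: H; exists (Ordinal (ilt : (i < size Ws)%N)).
have [f Hf] := choice sel.
have /injectivePn [i [j ij Eij]] : ~~ injectiveb f.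
  apply/negP => /injectiveP /leq_card; rewrite !card_ord; lia.
have [iWf _] := HW (f i).+1 (ltn_ord (f i)).
have Wj : nth setT Ws (f i) (w j) by rewrite Eij.
have := idealB iWf (Hf i) Wj.
have [x Ex] := local_unit (Hl i j (fun E => negP ij (introT eqP (val_inj E)))).
have -> : w i - w j = (l i - l j) * u by rewrite /w; ring.
move=> /(ideal_mulr x iWf); rewrite mulrAC Ex mul1r.
exact: (nu _ (ltn_ord (f i))).
Qed.

End Local.

(** * Finite generation of the Rees algebra *)

Section Powers.
Context {R : comNzRingType} {s : nat} (I : 'I_s -> set R).
Implicit Types (n q : 'X_{1..s}).

Lemma ideals_pow_gen i x : I i x -> ideals_pow I (Zs_mnm U_(i)) x.
Proof.
move=> Ix; rewrite /ideals_pow.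
have : i \in index_enum 'I_s by rewrite mem_index_enum.
have := index_enum_uniq 'I_s.
elim: (index_enum 'I_s) => // j r IH /= /andP [jr ur].
rewrite inE big_cons !ffunE mnm1E; have [E _|ij /= ir] := eqVneq i j.
  rewrite -{j}E in jr *.
  rewrite -[x]mulr1; apply: idealM_mul.
    by rewrite -[x]mulr1; apply: idealM_mul.
  elim: r jr {IH ur} => [|k t IHt]; first by rewrite big_nil.
  rewrite inE negb_or big_cons !ffunE mnm1E => /andP [ik it].
  rewrite (negPf ik) -[1 as X in _ X]mulr1.
  by apply: idealM_mul => //; exact: IHt.
by rewrite -[x]mul1r; apply: idealM_mul => //; exact: IH.
Qed.

(** An induction principle for products of powers: the family [I^n] is the least
    one of its kind. *)
Lemma ideals_pow_rec (T : 'X_{1..s} -> set R) : (forall n, ideal (T n)) ->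
  T 0%MM 1 -> (forall i n x y, I i x -> T n y -> T (U_(i) + n)%MM (x * y)) ->
  forall n, ideals_pow I (Zs_mnm n) `<=` T n.
Proof.
move=> iT T1 TI n.
have TX i k q x y : idealX (I i) k x -> T q y -> T (U_(i) *+ k + q)%MM (x * y).
  elim: k x => [|k IH] x.
    by rewrite mulm0n add0m => _; case: (iT q) => _ _; apply.
  move=> Hx Ty; rewrite mulmS -addmA.
  suff: idealX (I i) k.+1 `<=` [set x | T (U_(i) + (U_(i) *+ k + q))%MM (x * y)].
    by apply.
  apply: idealM_sub; first exact: ideal_colon.
  by move=> u v Iu Xv /=; rewrite -mulrA; apply: TI => //; exact: IH.
rewrite {2}[n]multinomUE_id /ideals_pow.
elim: (index_enum 'I_s) => [|i r IH].
  by rewrite !big_nil => x _; rewrite -[x]mulr1; case: (iT 0%MM) => _ _; apply.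
rewrite !big_cons; apply: idealM_sub => // x y.
rewrite !ffunE max_l ?lez_nat // => Xx /IH; exact: TX.
Qed.

Lemma idealXS (J : set R) j k : (j <= k)%N -> idealX J k `<=` idealX J j.
Proof.
move=> jk; rewrite -(subnK jk); elim: (k - j)%N => [//|d IH].
apply: subset_trans IH; rewrite addSn; apply: idealM_sub => [|x y _].
  exact: idealX_ideal.
by case: (idealX_ideal J (d + j)) => _ _; apply.
Qed.

Lemma ideals_powS (p q : Zs s) : (forall i, Num.max (p i) 0 <= Num.max (q i) 0) ->
  ideals_pow I q `<=` ideals_pow I p.
Proof.
move=> pq; rewrite /ideals_pow; elim/big_rec2: _ => // i A B _ AB.
apply: idealM_sub; first exact: idealM_ideal.
move=> x y Xx Ay; apply: idealM_mul; last exact: AB.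
by apply: idealXS Xx => //; have := pq i; lia.
Qed.

(** The family equal to [I_i I^{n - e_i}] where [n_i > 0] and to [I^n] elsewhere
    has the closure properties required by [ideals_pow_rec]. *)
Lemma ideals_pow_factor i n : (0 < n i)%N ->
  ideals_pow I (Zs_mnm n) `<=` idealM (I i) (ideals_pow I (Zs_mnm (n - U_(i))%MM)).
Proof.
pose T q := if (0 < q i)%N
  then idealM (I i) (ideals_pow I (Zs_mnm (q - U_(i))%MM))
  else ideals_pow I (Zs_mnm q).
have TP q : T q `<=` ideals_pow I (Zs_mnm q).
  rewrite /T; case: ifP => [qi|_]; last exact: subset_refl.
  apply: idealM_sub; first exact: ideals_pow_ideal.
  move=> x y /ideals_pow_gen Ix Iy; have := ideals_pow_mul Ix Iy.
  congr (ideals_pow _ (Zs_mnm _) _); apply/mnmP => j.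
  by rewrite mnmDE mnmBE mnm1E; case: eqP => [<-|_]; lia.
move=> ni; have : ideals_pow I (Zs_mnm n) `<=` T n; last by rewrite /T ni.
move: n {ni}; apply: ideals_pow_rec.
- by move=> n; rewrite /T; case: ifP => _; [exact: idealM_ideal|exact: ideals_pow_ideal].
- by rewrite /T mnm0E ltnn Zs_mnm0 ideals_pow0.
move=> j n x y Ix Ty; rewrite /T mnmDE mnm1E.
move: Ix; have [-> /= Ix|ji /= Ix] := eqVneq j i.
  apply: idealM_mul => //.
  have -> : (U_(i) + n - U_(i))%MM = n.
    by apply/mnmP => k; rewrite mnmBE mnmDE addKn.
  exact: TP.
move: Ty; rewrite /T add0n; case: ifP => [ni|_ Ty]; last first.
  by apply: ideals_pow_mul => //; exact: ideals_pow_gen.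
suff: idealM (I i) (ideals_pow I (Zs_mnm (n - U_(i))%MM)) `<=`
    [set y | idealM (I i) (ideals_pow I (Zs_mnm (U_(j) + n - U_(i))%MM)) (y * x)].
  by move=> H /H /=; rewrite mulrC.
apply: idealM_sub; first by apply: ideal_colon; exact: idealM_ideal.
move=> u v Iu Iv /=; rewrite -mulrA; apply: idealM_mul => //; rewrite mulrC.
have -> : (U_(j) + n - U_(i))%MM = (U_(j) + (n - U_(i)))%MM.
  apply/mnmP => k; rewrite mnmBE !mnmDE mnmBE.
  by rewrite [U_(i)%MM k]mnm1E; case: eqP => [<-|_]; lia.
by apply: ideals_pow_mul => //; exact: ideals_pow_gen.
Qed.

Lemma ideals_pow_nilpotent (m : set R) n : (forall i, radical (I i) = m) ->
  forall y, m y -> exists k, ideals_pow I (Zs_mnm n) (y ^+ k).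
Proof.
move=> rI y my.
have /choice [k Hk] : forall i, exists k, I i (y ^+ k).
  by move=> i; move: my; rewrite -(rI i).
exists (\sum_i k i * n i)%N; rewrite /ideals_pow.
elim/big_rec2: _ => // i A j _ IH; rewrite exprD; apply: idealM_mul => //.
rewrite exprM ffunE max_l ?lez_nat //; exact: idealX_expr.
Qed.

End Powers.

Section ReesNoetherian.
Context {R : comNzRingType} {s : nat} (I : 'I_s -> set R) (F : filtration I).
Hypotheses (nR : noetherian R) (iI : forall i, ideal (I i)) (aF : admissible F).
Implicit Types (n q a b : 'X_{1..s}) (x y z : R).

Notation G n := (F (Zs_mnm n)).

Lemma Zs_mnm_le a b : (a <= b)%MM -> Zs_le (Zs_mnm a) (Zs_mnm b).
Proof. by move=> /mnm_lepP ab i; rewrite !ffunE lez_nat. Qed.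

Lemma fil_mnmM a b x y : G a x -> G b y -> G (a + b)%MM (x * y).
Proof.
by move=> Gx Gy; rewrite Zs_mnmD; apply: fil_mul; apply: idealM_mul.
Qed.

Lemma fil_mnmS a b : (a <= b)%MM -> G b `<=` G a.
Proof. by move=> /Zs_mnm_le; apply: fil_le. Qed.

Lemma fil_mnm0 x : G 0%MM x.
Proof. by apply: fil_pow; rewrite Zs_mnm0 ideals_pow0. Qed.

Lemma fil_mnm_gen i x : I i x -> G U_(i)%MM x.
Proof. by move=> Ix; apply: fil_pow; exact: ideals_pow_gen. Qed.

(** Since [R'(F)] has finitely many homogeneous generators [g t^q] over
    [R'(I)], with [q] in [Z^s], those [g t^q'] with [q'] the positive part of
    [q] cut off at [n] suffice for the degrees [n] of [N^s]; the [q'] remain in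
    a bounded box. *)
Lemma admissible_gen : exists l : seq ('X_{1..s} * R),
  (forall p, p \in l -> G p.1 p.2) /\
  forall n (S : set R), S 0 -> (forall x y, S x -> S y -> S (x + y)) ->
    (forall p u, p \in l -> (p.1 <= n)%MM ->
       ideals_pow I (Zs_mnm (n - p.1)%MM) u -> S (u * p.2)) ->
    G n `<=` S.
Proof.
have [Fpos [k [g [Hg gen]]]] := aF.
have /choice [sup Hsup] : forall j, exists r : seq (Zs s), forall p, g j p != 0 -> p \in r.
  move=> j; have [/finite_seqP [r Er] _] := Hg j; exists r => p gp.
  by have : [set n | g j n != 0] p by []; rewrite Er.
pose M := (\max_(j < k) \max_(p <- sup j) \max_(i < s) `|p i|)%N.
have HM j p i : g j p != 0 -> (`|p i| <= M)%N.
  move=> /Hsup pj; apply: leq_trans (leq_bigmax j).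
  apply: leq_trans (@leq_bigmax_seq _ _ xpredT (fun p : Zs s => \max_(i < s) `|p i|)%N p pj isT).
  exact: (leq_bigmax (F := fun i => `|p i|%N)).
pose box := [seq [multinom (f i : nat) | i < s] |
  f : {ffun 'I_s -> 'I_M.+1} <- enum {ffun 'I_s -> 'I_M.+1}].
pose gs := [seq g j p | j <- enum 'I_k, p <- sup j].
exists [seq p <- [seq (q, c) | q <- box, c <- gs] | `[< G p.1 p.2 >]].
split; first by move=> p; rewrite mem_filter => /andP [/asboolP].
move=> n S S0 SD SM x Gx.
pose f (p : Zs s) := if p == Zs_mnm n then x else 0.
have [|a [Ha /(congr1 (@^~ (Zs_mnm n)))]] := gen f.
  split; last by move=> p; rewrite /f; case: eqP => [->//|_]; case: (fil_ideal F p).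
  apply: (sub_finite_set (B := [set Zs_mnm n])); last exact: finite_set1.
  by move=> p /=; rewrite /f; have [->|_] := eqVneq p (Zs_mnm n); rewrite ?eqxx.
rewrite /f eqxx => ->; apply: big_ind => // j _; rewrite /laurent_mul.
apply: big_ind => // p _.
have [->|gp] := eqVneq (g j (Zs_mnm n - p)) 0; first by rewrite mulr0.
pose pos i : int := Num.max ((Zs_mnm n - p) i) 0.
pose q := [multinom minn (n i) `|pos i|%N | i < s].
apply: (SM (q, g j (Zs_mnm n - p))).
- rewrite mem_filter; apply/andP; split.
    apply/asboolP => /=; have [_ /(_ (Zs_mnm n - p))] := Hg j.
    rewrite Fpos; apply: fil_le => i; rewrite !ffunE mnmE /pos !ffunE; lia.
  apply: allpairs_f; last first.
    by apply/allpairsPdep; exists j, (Zs_mnm n - p); rewrite mem_enum; split=> //;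
      exact: Hsup.
  apply/mapP; exists [ffun i => inord (q i)]; first by rewrite mem_enum.
  apply/mnmP => i; rewrite mnmE ffunE inordK // ltnS mnmE geq_min.
  by apply/orP; right; have := HM _ _ i gp; rewrite /pos; lia.
- by apply/mnm_lepP => i; rewrite mnmE geq_minl.
- have [_ /(_ p)] := Ha j; apply: ideals_powS => // i.
  by rewrite !ffunE mnmBE mnmE /pos !ffunE; lia.
Qed.

(** In degrees beyond those of all generators, each generator comes with a
    coefficient in a positive power of [I_i]. *)
Lemma fil_factor : exists N, forall i n, (N <= n i)%N ->
  G n `<=` idealM (I i) (G (n - U_(i))%MM).
Proof.
have [l [Gl gen]] := admissible_gen.
exists (\max_(p <- l) \max_(i < s) p.1 i).+1 => i n Nn.
have iM := idealM_ideal (I i) (G (n - U_(i))%MM); have [M0 MD _] := iM.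
apply: gen => // p u pl pn.
have pni : (p.1 i < n i)%N.
  apply: leq_trans Nn; rewrite ltnS.
  apply: leq_trans (@leq_bigmax_seq _ _ xpredT
    (fun p : 'X_{1..s} * R => \max_(i < s) p.1 i)%N p pl isT).
  exact: (leq_bigmax (F := fun i => p.1 i)).
move=> /(ideals_pow_factor (i := i)).
rewrite mnmBE subn_gt0 => /(_ pni); move: u; apply: idealM_sub.
  exact: ideal_colon.
move=> x y Ix Iy /=; rewrite -mulrA; apply: idealM_mul => //.
have := fil_mnmM (@fil_pow _ _ _ F _ _ Iy) (Gl _ pl).
congr (F (Zs_mnm _) _); apply/mnmP => j; rewrite mnmDE !mnmBE mnm1E.
move/mnm_lepP: pn => /(_ j); case: eqP => [<-|_]; lia.
Qed.

(** [K n] stands for the degree [n] component [K n & F n] of a homogeneous ideal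
    of [R(F)]; leaving out the intersection allows constant families. *)
Definition graded_ideal (K : 'X_{1..s} -> set R) : Prop :=
  (forall n, ideal (K n)) /\
  forall a b x y, G a x -> K b y -> K (a + b)%MM (x * y).

(** [R(F)] is noetherian, being an image [psi] of a polynomial ring over [R]
    in finitely many variables. *)
Lemma graded_ideal_max (C : ('X_{1..s} -> set R) -> Prop) :
  (exists K, C K) -> (forall K, C K -> graded_ideal K) ->
  exists2 K, C K & forall K', C K' -> (forall n, K n `<=` K' n) ->
    forall n x, G n x -> K' n x -> K n x.
Proof.
move=> [K0 CK0] Cg.
have [l [Gl gen]] := admissible_gen.
have /choice [X HX] : forall i, exists X : seq R, I i = ideal_gen [set x | x \in X].
  by move=> i; exact: nR.
pose ts := [seq c *: 'X_[U_(i)] | i <- enum 'I_s, c <- X i] ++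
  [seq p.2 *: 'X_[p.1] | p <- l] : seq {mpoly R[s]}.
have [D [psi [nD imR iml imB]]] := fg_algebra_cover (@mpolyC s R) ts nR.
pose B : set {mpoly R[s]} := [set p | forall n, G n p@_n].
have G0 n : G n 0 by case: (fil_ideal F (Zs_mnm n)).
have termB n x : G n x -> B (x *: 'X_[n]).
  by move=> Gx q; rewrite mcoeffZ mcoeffX; case: eqP => [<-|_]; rewrite ?mulr1 ?mulr0.
have psiB d : B (psi d).
  apply: imB => [p q Bp Bq n|p q Bp Bq n|r n|c].
  - by rewrite mcoeffD; case: (fil_ideal F (Zs_mnm n)) => _ + _; apply.
  - apply: ideal_mcoeffM => [|a b ->]; [exact: fil_ideal|exact: fil_mnmM].
  - by rewrite mcoeffC; case: eqP => [->|_]; rewrite ?mulr0 //; exact: fil_mnm0.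
  - rewrite mem_cat => /orP [/allpairsPdep [i [x [_ xX ->]]]|/mapP [p /Gl Gp ->]].
      apply: termB; apply: fil_mnm_gen; rewrite HX; exact: ideal_gen_mem.
    exact: termB.
pose im (p : {mpoly R[s]}) := exists d, psi d = p.
have imD (p p' : {mpoly R[s]}) : im p -> im p' -> im (p + p').
  by move=> [d <-] [d' <-]; exists (d + d'); rewrite rmorphD.
have imM (p p' : {mpoly R[s]}) : im p -> im p' -> im (p * p').
  by move=> [d <-] [d' <-]; exists (d * d'); rewrite rmorphM.
have imZ (c : R) (p : {mpoly R[s]}) : im p -> im (c *: p).
  by move=> ip; rewrite -mul_mpolyC; apply: imM => //; exact: imR.
have im0 : im 0 by exists 0; rewrite rmorph0.
have imI n u : ideals_pow I (Zs_mnm n) u -> im (u *: 'X_[n]).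
  pose T n : set R := [set u | im (u *: 'X_[n])].
  apply: (ideals_pow_rec (T := T)) => {n u}.
  - move=> n; split; rewrite /T /= ?scale0r //.
      by move=> x y; rewrite scalerDl; exact: imD.
    by move=> c x; rewrite -scalerA; exact: imZ.
  - by rewrite /T /= scale1r mpolyX0; exists 1; rewrite rmorph1.
  - move=> i n x y Ix; rewrite /T /= => imy.
    have -> : (x * y) *: 'X_[U_(i) + n] = (x *: 'X_[U_(i)]) * (y *: 'X_[n]) :> {mpoly R[s]}.
      by rewrite mpolyXD -scalerAl -scalerAr scalerA.
    apply: imM => //; move: x Ix; rewrite HX.
    apply: ideal_gen_sub => /=.
      split; rewrite /= ?scale0r //.
        by move=> v w; rewrite scalerDl; exact: imD.
      by move=> c v; rewrite -scalerA; exact: imZ.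
    move=> x /= xX; apply: iml; rewrite mem_cat; apply/orP; left.
    by apply/allpairsPdep; exists i, x; rewrite mem_enum.
have imG n x : G n x -> im (x *: 'X_[n]).
  move: x; apply: (gen n [set x | im (x *: 'X_[n])]) => /=.
  - by rewrite scale0r.
  - by move=> x y; rewrite scalerDl; exact: imD.
  - move=> p u pl pn /imI imu.
    have -> : (u * p.2) *: 'X_[n] =
        (u *: 'X_[n - p.1]) * (p.2 *: 'X_[p.1]) :> {mpoly R[s]}.
      by rewrite -scalerAl -scalerAr scalerA -mpolyXD submK.
    apply: imM => //; apply: iml; rewrite mem_cat; apply/orP; right.
    exact: (map_f (fun p => p.2 *: 'X_[p.1]) pl).
pose hat (K : 'X_{1..s} -> set R) : set D := [set d | forall n, K n (psi d)@_n].
have ihat K : graded_ideal K -> ideal (hat K).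
  move=> [iK KM]; split.
  - by move=> n; rewrite rmorph0 mcoeff0; case: (iK n).
  - by move=> d d' Kd Kd' n; rewrite rmorphD mcoeffD; case: (iK n) => _ + _; apply.
  - move=> d d' Kd n; rewrite rmorphM; apply: ideal_mcoeffM => // a b ->.
    by apply: KM => //; exact: psiB.
have [_ [K CK <-] maxK] := noetherian_max nD
  (C := fun L => exists2 K, C K & hat K = L)
  (ex_intro _ _ (ex_intro2 _ _ K0 CK0 erefl))
  (fun L '(ex_intro2 K CK E) => eq_ind _ ideal (ihat K (Cg K CK)) _ E).
exists K => // K' CK' KK' n x Gx K'x.
have [d Ed] := imG n x Gx.
have : hat K d.
  apply: (maxK (hat K')); [by exists K'|by move=> d' Kd' q; apply: KK'; exact: Kd'|].
  move=> q; rewrite Ed mcoeffZ mcoeffX; case: eqP => [<-|_]; rewrite ?mulr1 ?mulr0 //.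
  by case: (Cg _ CK') => /(_ q) [].
by move=> /(_ n); rewrite Ed mcoeffZ mcoeffX eqxx mulr1.
Qed.

End ReesNoetherian.

(** * Superficial elements *)

Section Superficial.
Context {R : comNzRingType} (m : set R) {s : nat} (I : 'I_s -> set R)
  (F : filtration I).
Hypotheses (nR : noetherian R) (locm : local_ring m)
  (infm : infinite_residue_field m) (rI : forall i, is_primary_to m (I i))
  (aF : admissible F).
Implicit Types (n q : 'X_{1..s}) (x y z b : R) (J W : set R) (c N : nat).

Notation G n := (F (Zs_mnm n)).

Definition mnm_const c : 'X_{1..s} := [multinom c | i < s].

Lemma mnm_const_leP c n : reflect (forall i, (c <= n i)%N) (mnm_const c <= n)%MM.
Proof.
by apply: (iffP mnm_lepP) => H i; have := H i; rewrite mnmE.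
Qed.

Let iI i : ideal (I i). Proof. by case: (rI i) => -[]. Qed.

Lemma fil_nilpotent n : nilpotent_mod m (G n).
Proof.
move=> y my.
have [k Ik] := ideals_pow_nilpotent n (fun i => proj2 (rI i)) my.
by exists k; exact: fil_pow Ik.
Qed.

Lemma large_fil_sub (i : 'I_s) : exists N, forall n, (mnm_const N <= n)%MM -> G n `<=` m.
Proof.
have [N HN] := fil_factor aF; exists N => n /mnm_const_leP /(_ i) /HN.
move=> Gn x /Gn; apply: idealM_sub; first exact: local_ideal.
move=> u v Iu _; apply: ideal_mulr; first exact: local_ideal.
by rewrite -(proj2 (rI i)); exists 1%N.
Qed.

(** Noetherian induction on [K].  If [K] is proper in [R(F)], choose [y] so
    that the annihilator [p] of [y] modulo [K] is maximal, and apply the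
    induction hypothesis to [K' = K + (y)].  If [p] contains [I_i t_i], then
    [K] and [K'] agree in large degrees.  Otherwise [{a | a t_i in p}] is one
    more ideal to avoid: an element [a] outside it kills no nonzero multiple of
    [y] modulo [K], as the annihilator of such a multiple is again [p]. *)
Lemma nonzerodivisor_large (i : 'I_s) (K : 'X_{1..s} -> set R) : graded_ideal F K ->
  exists (Ws : seq (set R)) c,
    (forall j, (j < size Ws)%N ->
       ideal (nth setT Ws j) /\ ~ I i `<=` nth setT Ws j) /\
    forall a, I i a -> (forall j, (j < size Ws)%N -> ~ nth setT Ws j a) ->
      forall n x, (mnm_const c <= n)%MM -> G n x -> K (U_(i) + n)%MM (a * x) -> K n x.
Proof.
pose good K := exists (Ws : seq (set R)) c,
    (forall j, (j < size Ws)%N ->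
       ideal (nth setT Ws j) /\ ~ I i `<=` nth setT Ws j) /\
    forall a, I i a -> (forall j, (j < size Ws)%N -> ~ nth setT Ws j a) ->
      forall n x, (mnm_const c <= n)%MM -> G n x -> K (U_(i) + n)%MM (a * x) -> K n x.
move=> gK0; rewrite -/(good K); apply: contrapT => bK0.
have {K gK0 bK0} [K [gK bK] maxK] := graded_ideal_max nR iI aF
  (C := fun K => graded_ideal F K /\ ~ good K)
  (ex_intro _ K (conj gK0 bK0)) (fun K => @proj1 _ _).
have [iK KM] := gK.
pose ann n y q : set R := [set r | K (q + n)%MM (r * y)].
have ann_graded n y : graded_ideal F (ann n y).
  split=> [q|a b r x Gr]; last by rewrite /ann /= -addmA -mulrA; exact: KM.
  have [K0 KD KMl] := iK (q + n)%MM; rewrite /ann; split=> /=.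
  - by rewrite mul0r.
  - by move=> x z; rewrite mulrDl; exact: KD.
  - by move=> r x; rewrite -mulrA; exact: KMl.
have [|p [n [y [Gy nKy ->]]] maxp] := graded_ideal_max nR iI aF
    (C := fun p => exists n y, [/\ G n y, ~ K n y & p = ann n y]) _
    (fun p '(ex_intro n (ex_intro y (And3 _ _ E))) =>
       eq_ind_r _ (ann_graded n y) E).
  apply: contrapT => none; apply: bK; exists [::], 0%N; split=> // a _ _ n x _ Gx _.
  by apply: contrapT => nKx; apply: none; exists (ann n x), n, x.
pose K' q : set R :=
  [set z | exists r, (r = 0 \/ (n <= q)%MM /\ G (q - n)%MM r) /\ K q (z - r * y)].
have gK' : graded_ideal F K'.
  split=> [q|a b r z Gr [t [Ht Kzt]]].
    have [K0 KD KMl] := iK q; split.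
    - by exists 0; rewrite mul0r subr0; split=> //; left.
    - move=> z z' [r [Hr Kzr]] [r' [Hr' Kzr']].
      exists (r + r'); split; last by rewrite mulrDl opprD addrACA; exact: KD.
      have [_ GD _] := fil_ideal F (Zs_mnm (q - n)%MM).
      case: Hr Hr' => [->|[nq Gr]] [->|[nq' Gr']]; rewrite ?addr0 ?add0r;
        by [left|right; split=> //; exact: GD].
    - move=> a z [r [Hr Kzr]]; exists (a * r); split.
        case: Hr => [->|[nq Gr]]; [by left; rewrite mulr0|right; split=> //].
        by case: (fil_ideal F (Zs_mnm (q - n)%MM)) => _ _; apply.
      by rewrite -mulrA -mulrBr; exact: KMl.
  exists (r * t); split; last by rewrite -mulrA -mulrBr; exact: KM.
  case: Ht => [->|[nb Gt]]; [by left; rewrite mulr0|right].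
  split; first exact: lepm_trans nb (lem_addl _ _).
  by rewrite -addmBA //; exact: fil_mnmM.
have K'K q : K q `<=` K' q.
  by move=> z Kz; exists 0; rewrite mul0r subr0; split=> //; left.
have [Ws [c [HWs Hc]]] : good K'.
  apply: contrapT => bK'; apply: nKy.
  apply: (maxK K') => //; exists 1; rewrite mul1r subrr.
  split; last by case: (iK n).
  right; rewrite lepm_refl; split=> //.
  have -> : (n - n)%MM = 0%MM by apply/mnmP => j; rewrite mnmBE mnm0E subnn.
  exact: fil_mnm0.
pose W := ann n y U_(i)%MM.
have [IW|nIW] := pselect (I i `<=` W).
  have [N HN] := fil_factor aF.
  (* From this degree on, a multiplier [r] of [y] lies in [I_i F(q - n - e_i)],
     so that [r y] is in [K]. *)
  apply: bK; exists Ws, (maxn c (N + n i).+1); split=> // a Ia aWs q x /mnm_const_leP qc Gx Kax.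
  have : K' q x.
    apply: (Hc a) => //; last exact: K'K.
    by apply/mnm_const_leP => j; apply: leq_trans (qc j); exact: leq_maxl.
  case=> r [[->|[nq Gr]]]; first by rewrite mul0r subr0.
  move=> /(ideal_subK (iK q)); apply.
  have Nq : (N < (q - n)%MM i)%N.
    have := qc i; have := leq_maxr c (N + n i).+1; rewrite mnmBE; lia.
  have: idealM (I i) (G (q - n - U_(i))%MM) r by apply: HN Gr; exact: ltnW.
  suff: idealM (I i) (G (q - n - U_(i))%MM) `<=` [set r | K q (r * y)] by apply.
  apply: idealM_sub; first exact: ideal_colon.
  move=> u v /IW; rewrite /W /ann /= => Ku Gv.
  have := KM _ _ _ _ Gv Ku; rewrite mulrCA mulrA; congr (K _ _).
  rewrite addmA -[RHS](submK nq); congr (_ + _)%MM.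
  rewrite submK //; apply/mnm_lepP => j; rewrite mnm1E.
  by case: eqP => [<-|//]; exact: leq_trans Nq.
apply: bK; exists (W :: Ws), c; split.
  move=> [_|j]; last exact: (HWs j).
  by split=> //; exact: (proj1 (ann_graded n y)).
move=> a Ia aWs q x cq Gx Kax.
have : K' q x by apply: (Hc a) => //; [move=> j; exact: (aWs j.+1)|exact: K'K].
case=> r [[->|[nq Gr]]]; first by rewrite mul0r subr0.
move=> Kxr; apply: (ideal_subK (iK q) Kxr).
apply: contrapT => nKry; apply: (aWs 0%N) => //=.
have Gry : G q (r * y) by rewrite -(submK nq); exact: fil_mnmM.
apply: (maxp (ann q (r * y))).
- by exists q, (r * y).
- move=> t z; rewrite /ann /= => Kzy.
  have := KM _ _ _ _ Gr Kzy; rewrite mulrCA; congr (K _ _).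
  by rewrite addmA (addmC (q - n)%MM) -addmA submK.
- exact: fil_mnm_gen.
rewrite /ann /=; have := KM _ _ _ _ (fil_mnm_gen F Ia) Kxr.
rewrite mulrBr => Kd; exact: (ideal_subKr (iK _) Kd).
Qed.

(** Artin-Rees, with [e = (1, ..., 1)]: the submodules
    [{z | z in b F(n - c e) + J}] increase with [c] to all of
    [F(n) & (bR + J)], because [F(n - c e) = R] for large [c]. *)
Lemma artin_rees J b : ideal J -> exists c, forall n z r,
  G n z -> J (z - b * r) -> exists2 w, G (n - mnm_const c)%MM w & J (z - b * w).
Proof.
move=> iJ; have [J0 JD JM] := iJ.
pose K c n : set R := [set z | exists2 w, G (n - mnm_const c)%MM w & J (z - b * w)].
have gK c : graded_ideal F (K c).
  split=> [n|p q x z Gx [w Gw Jw]].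
    have [G0 GD GM] := fil_ideal F (Zs_mnm (n - mnm_const c)%MM); split.
    - by exists 0; rewrite ?mulr0 ?subr0.
    - move=> z z' [w Gw Jw] [w' Gw' Jw']; exists (w + w'); first exact: GD.
      by rewrite mulrDr opprD addrACA; exact: JD.
    - move=> r z [w Gw Jw]; exists (r * w); first exact: GM.
      by rewrite mulrCA -mulrBr; exact: JM.
  exists (x * w); last by rewrite mulrCA -mulrBr; exact: JM.
  apply: fil_mnmS (fil_mnmM Gx Gw); apply/mnm_lepP => j.
  by rewrite mnmBE !mnmDE mnmBE; lia.
have KS c c' n : (c <= c')%N -> K c n `<=` K c' n.
  move=> cc' z [w Gw Jw]; exists w => //; apply: fil_mnmS Gw.
  by apply/mnm_lepP => j; rewrite !mnmBE !mnmE; lia.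
have [_ [c ->] maxc] := graded_ideal_max nR iI aF
  (C := fun L => exists c, L = K c) (ex_intro _ _ (ex_intro _ 0%N erefl))
  (fun L '(ex_intro c E) => eq_ind_r _ (gK c) E).
exists c => n z r Gz Jz.
(* [n - c' e] is truncated to [0]. *)
pose c' := maxn c (\max_(j < s) n j)%N.
apply: (maxc (K c')) => //; first by exists c'.
  by move=> q; apply: KS; exact: leq_maxl.
exists r => //; have -> : (n - mnm_const c')%MM = 0%MM.
  apply/mnmP => j; rewrite mnmBE mnm0E mnmE; apply/eqP; rewrite subn_eq0.
  apply: leq_trans (leq_maxr _ _); exact: (leq_bigmax (F := fun j => n j)).
exact: fil_mnm0.
Qed.

(** Krull's intersection theorem: by Artin-Rees applied to [b = x], the
    element [x] lies in [mx + J]. *)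
Lemma krull_intersection (i : 'I_s) J x : ideal J ->
  (forall n, idealD (G n) J x) -> J x.
Proof.
move=> iJ Jx; have [c Hc] := artin_rees x iJ.
have [N HN] := large_fil_sub i.
have [f Gf Jf] := Jx (mnm_const (c + N)).
have [|w Gw Jw] := Hc _ f 1 Gf.
  by rewrite mulr1 -opprB; exact: idealN.
apply: (local_cancel nR locm (w := w)) => //.
  apply: HN Gw; apply/mnm_const_leP => j; rewrite mnmBE !mnmE; lia.
have -> : (1 - w) * x = (x - f) + (f - x * w) by ring.
by case: iJ => _ + _; apply.
Qed.

Definition socle_free J : Prop :=
  forall x, (forall y, m y -> J (y * x)) -> J x.

(** An element [b] of [I_i] outside finitely many ideals is a nonzerodivisor in
    large degrees both on [+_n F(n)/(F(n) & (F(n + e) + J))] and on the image of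
    [R(F)] in [(R/J)[t]], where [e = (1, ..., 1)].  The latter makes it regular on [R/J], whose socle is zero.
    If now [b x] lies in [F(n + e_i) + J], then [x] lies in [F(n - c e) + J] by
    Artin-Rees, and the former property improves this to [F(n) + J] by steps of
    [e]. *)
Lemma superficial_exists (i : 'I_s) J : ideal J -> socle_free J ->
  exists b, [/\ I i b, forall x, J (b * x) -> J x &
    exists N, forall n x, (mnm_const N <= n)%MM ->
      idealD (G (U_(i) + n)%MM) J (b * x) -> idealD (G n) J x].
Proof.
move=> iJ socJ; have [J0 JD JM] := iJ.
pose K1 n := idealD (G (n + mnm_const 1)%MM) J.
have gK1 : graded_ideal F K1.
  split=> [n|p q x z Gx [w Gw Jw]]; first by apply: idealD_ideal => //; exact: fil_ideal.
  exists (x * w); last by rewrite -mulrBr; exact: JM.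
  by rewrite -addmA; exact: fil_mnmM.
have gK2 : graded_ideal F (fun=> J) by split=> // *; exact: JM.
have [Ws1 [c1 [HWs1 Hc1]]] := nonzerodivisor_large i gK1.
have [Ws2 [c2 [HWs2 Hc2]]] := nonzerodivisor_large i gK2.
have [j|b Ib bWs] := ideal_avoidance nR locm (Ws := Ws1 ++ Ws2) infm (iI i).
  rewrite size_cat nth_cat; move=> jlt; case: (ltnP j) => [j1|j1]; first exact: HWs1.
  by apply: HWs2; lia.
have {}Hc1 : forall n x, (mnm_const c1 <= n)%MM -> G n x -> K1 (U_(i) + n)%MM (b * x) ->
    K1 n x.
  apply: Hc1 => // j jlt H; apply: (bWs j); last by rewrite nth_cat jlt.
  by rewrite size_cat ltn_addr.
have {}Hc2 : forall n x, (mnm_const c2 <= n)%MM -> G n x -> J (b * x) -> J x.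
  apply: Hc2 => // j jlt H; apply: (bWs (size Ws1 + j)%N).
    by rewrite size_cat ltn_add2l.
  by rewrite nth_cat ltnNge leq_addr /= addKn.
have reg x : J (b * x) -> J x.
  move=> Jbx; apply: contrapT => nJx.
  have [|y my|r nJr Jr] := socle_exists nR (m := m) (colon_ideal x iJ).
  - by rewrite /colon /= mulr1.
  - have [k Gk] := fil_nilpotent (mnm_const c2) my; exists k.
    apply: (Hc2 _ _ (lepm_refl _)); first by rewrite mulrC; apply: ideal_mulr Gk; exact: fil_ideal.
    by rewrite mulrA; exact: ideal_mulr.
  - apply: nJr; apply: socJ => y /Jr; rewrite /colon /=; by rewrite mulrCA.
exists b; split=> //.
have [c Hc] := artin_rees b iJ.
exists (c1 + c)%N => n x /mnm_const_leP Nn [g Gg Jg].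
have [|w Gw Jw] := Hc _ g x Gg; first by rewrite -opprB; exact: idealN.
apply: (@idealD_idem _ _ _ _ w) => //.
  apply: reg; rewrite mulrBr -(subrKA g); exact: JD.
suff H k : (k <= c)%N -> idealD (G (n - mnm_const (c - k))%MM) J w.
  have := H c (leqnn c); rewrite subnn; congr (idealD (F (Zs_mnm _)) _ _).
  by apply/mnmP => j; rewrite mnmBE mnmE subn0.
elim: k => [_|k IH kc].
  rewrite subn0; apply: idealD_l => //; apply: fil_mnmS Gw.
  by apply/mnm_lepP => j; rewrite !mnmBE mnmDE; lia.
have [w' Gw' Jw'] := IH (ltnW kc); set q := (n - _)%MM in Gw'.
have qE : (n - mnm_const (c - k.+1))%MM = (q + mnm_const 1)%MM.
  by apply/mnmP => j; have := Nn j; rewrite mnmDE !mnmBE !mnmE; lia.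
apply: (@idealD_idem _ _ _ _ w') => //; rewrite qE.
apply: Hc1 Gw' _; first by apply/mnm_const_leP => j; have := Nn j; rewrite mnmBE mnmE; lia.
exists g; last first.
  have -> : b * w' - g = - (b * (w - w')) - (g - b * w) by ring.
  by apply: idealB => //; apply: idealN => //; exact: JM.
apply: fil_mnmS Gg; apply/mnm_lepP => j; have := Nn j.
by rewrite !mnmDE mnmBE !mnmE; lia.
Qed.

End Superficial.

(** * Hilbert functions with linear Hilbert polynomial *)

Lemma mnm_nat_ind s (Q : 'X_{1..s} -> Prop) : Q 0%MM ->
  (forall i n, Q n -> Q (U_(i) + n)%MM) -> forall n, Q n.
Proof.
move=> Q0 QS n; rewrite [n]multinomUE_id.
apply: big_rec => // i q _ Qq; elim: (n i) => [|k IH].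
  by rewrite mulm0n add0m.
by rewrite mulmS -addmA; exact: QS.
Qed.

Section LinearLength.
Context {R : comNzRingType} (m : set R) {s : nat} (I : 'I_s -> set R)
  (F : filtration I).
Hypotheses (nR : noetherian R) (locm : local_ring m)
  (infm : infinite_residue_field m) (rI : forall i, is_primary_to m (I i))
  (aF : admissible F).
Implicit Types (n q : 'X_{1..s}) (x y z b : R) (J : set R) (c : 'I_s -> rat).

Notation G n := (F (Zs_mnm n)).

Lemma finite_length_fil n J : ideal J -> finite_length (idealD (G n) J).
Proof.
move=> iJ; apply: (nilpotent_mod_finite_length nR locm).
  by apply: idealD_ideal => //; exact: fil_ideal.
apply: nilpotent_modS (fil_nilpotent F rI n) => x; exact: idealD_l.
Qed.

Definition linear_form c n : rat := \sum_i c i * (n i)%:R.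

Lemma linear_formD c n q : linear_form c (n + q)%MM = linear_form c n + linear_form c q.
Proof.
by rewrite -big_split /=; apply: eq_bigr => i _; rewrite mnmDE natrD mulrDr.
Qed.

Lemma linear_form0 c : linear_form c 0%MM = 0.
Proof. by rewrite /linear_form big1 // => i _; rewrite mnm0E mulr0. Qed.

Lemma linear_formU c i : linear_form c U_(i)%MM = c i.
Proof.
rewrite /linear_form (bigD1 i) //= mnm1E eqxx mulr1 big1 ?addr0 // => j ji.
by rewrite mnm1E eq_sym (negPf ji) mulr0.
Qed.

(** For [b] superficial, [l(R/(F(n + e_i) + J + bR))] is, for large [n], the
    increment [c_i] of the length; being constant, it is [l(R/(J + bR))] by
    Krull's intersection theorem.  As [b F(n)] lies in [F(n + e_i)], this bounds
    the increment in every degree. *)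
Lemma length_increment i J c : ideal J -> socle_free m J ->
  (exists N, forall n, (mnm_const N <= n)%MM ->
     (lambda_quot (idealD (G n) J))%:R = linear_form c n) ->
  forall n, (lambda_quot (idealD (G (U_(i) + n)%MM) J))%:R <=
    c i + (lambda_quot (idealD (G n) J))%:R.
Proof.
move=> iJ socJ [N0 HN0].
have [b [Ib _ [N1 HN1]]] := superficial_exists nR locm infm rI aF i iJ socJ.
have ib := principal_ideal b.
pose K n := idealD (G (U_(i) + n)%MM) J.
have iK n : ideal (K n) by apply: idealD_ideal => //; exact: fil_ideal.
have subc n : idealD (G n) J `<=` colon (K n) b.
  move=> x [w Gw Jw]; exists (b * w).
    by apply: fil_mnmM => //; exact: fil_mnm_gen.
  by rewrite -mulrBr; case: iJ => _ _; apply.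
pose T n := idealD (K n) (principal b).
have finT n : finite_length (T n).
  apply: finite_lengthS (finite_length_fil (U_(i) + n)%MM iJ).
  by move=> x; exact: idealD_l.
have add n : lambda_quot (K n) =
    (lambda_quot (colon (K n) b) + lambda_quot (T n))%N.
  have := lambda_quot_colon (b := b) (iK n) _ (finT n).
  by case=> //; exact: finite_lengthS (@subc n) (finite_length_fil n iJ).
pose N := maxn N0 N1.
have TE n : (mnm_const N <= n)%MM -> (lambda_quot (T n))%:R = c i.
  move=> /mnm_const_leP Nn.
  have n0 : (mnm_const N0 <= n)%MM.
    by apply/mnm_const_leP => j; exact: leq_trans (leq_maxl _ _) (Nn j).
  have n1 : (mnm_const N1 <= n)%MM.
    by apply/mnm_const_leP => j; exact: leq_trans (leq_maxr _ _) (Nn j).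
  have cE : colon (K n) b = idealD (G n) J.
    by rewrite eqEsubset; split=> // x; exact: HN1.
  have := congr1 (fun k : nat => k%:R : rat) (add n).
  rewrite natrD cE HN0 // HN0; last exact: lepm_trans n0 (lem_addl _ _).
  by rewrite linear_formD linear_formU addrC => /addrI.
pose Jb := idealD J (principal b).
have iJb : ideal Jb by exact: idealD_ideal.
have TS n q : (n <= q)%MM -> T q `<=` T n.
  move=> nq; apply: idealDS; apply: idealDS; apply: fil_mnmS.
  by apply/mnm_lepP => j; rewrite !mnmDE leq_add2l; exact: (mnm_lepP nq).
have JbT n : Jb `<=` T n.
  by apply: idealDS => x; apply: idealD_r; exact: fil_ideal.
have TJb : T (mnm_const N) = Jb.
  rewrite eqEsubset; split=> // x Tx.
  apply: (krull_intersection nR locm rI aF i iJb) => n.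
  have Nq : (mnm_const N <= n + mnm_const N)%MM by exact: lem_addl.
  have Tqx : T (n + mnm_const N)%MM x.
    apply: (lambda_quot_eqS _ (finT _) (TS _ _ Nq)) Tx; first exact: idealD_ideal.
    by apply/eqP; rewrite -(eqr_nat rat) !TE ?lepm_refl.
  move: x Tqx {Tx}; apply: idealD_sub.
  - by apply: idealD_ideal => //; exact: fil_ideal.
  - apply: idealD_sub; first by apply: idealD_ideal => //; exact: fil_ideal.
      move=> x Gx; apply: idealD_l => //; apply: fil_mnmS Gx.
      by apply/mnm_lepP => j; rewrite !mnmDE; lia.
    by move=> x Jx; apply: idealD_r; [exact: fil_ideal|exact: idealD_l].
  - by move=> x bx; apply: idealD_r; [exact: fil_ideal|exact: idealD_r].
move=> n; rewrite -(TE (mnm_const N)) ?lepm_refl // -natrD ler_nat -/(K n) add addnC.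
apply: leq_add; last exact: lambda_quotS (finite_length_fil n iJ) (@subc n).
by apply: lambda_quotS => //; rewrite TJb.
Qed.

(** The difference between the two sides is nonincreasing by
    [length_increment], and it is zero in degree [0] and in all large degrees. *)
Lemma linear_hilbert_fun J c : ideal J -> socle_free m J ->
  (exists N, forall n, (mnm_const N <= n)%MM ->
     (lambda_quot (idealD (G n) J))%:R = linear_form c n) ->
  forall n, (lambda_quot (idealD (G n) J))%:R = linear_form c n.
Proof.
move=> iJ socJ [N HN] n.
pose D q : rat := (lambda_quot (idealD (G q) J))%:R - linear_form c q.
have DS q k : D (q + k)%MM <= D k.
  elim/mnm_nat_ind: q => [|i q IH]; first by rewrite add0m.
  apply: le_trans IH; rewrite -addmA /D linear_formD linear_formU.
  have := length_increment i iJ socJ (ex_intro _ N HN) (q + k)%MM.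
  by rewrite opprD addrA lerD2r lerBlDl.
have D0 : D 0%MM = 0.
  rewrite /D linear_form0 subr0 lambda_quot1 //; apply: idealD_l => //.
  exact: fil_mnm0.
have Dlarge : D (mnm_const N + n)%MM = 0 by rewrite /D HN ?subrr // lem_addr.
have Dle : D n <= 0 by rewrite -D0 -{1}[n]addm0.
have Dge : 0 <= D n by rewrite -Dlarge.
by apply/eqP; rewrite -subr_eq0 eq_le -/(D n) Dle.
Qed.

End LinearLength.

(** * The first local cohomology of the Rees module *)

Section LocalCohomology.
Context {R : comNzRingType} {s : nat} (I : 'I_s -> set R) (F : filtration I).
Implicit Types (n q : 'X_{1..s}) (x y u b : R).

Fact unit_fil_ideal (n : Zs s) : ideal [set: R]. Proof. exact: idealT. Qed.

(** Its Rees module is the whole polynomial ring [R[t]]. *)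
Definition unit_filtration : filtration I :=
  @Filtration R s I (fun=> setT) unit_fil_ideal (fun _ _ _ => Logic.I)
    (fun _ _ _ _ => Logic.I) (fun _ _ _ _ _ => Logic.I).

Fact rees_incl_subproof (p : rees_mod F) :
  (p : {mpoly R[s]}) \in rees_mod_pred unit_filtration.
Proof. exact/rees_mod_predP. Qed.

Definition rees_incl (p : rees_gmod F) : rees_gmod unit_filtration :=
  ReesMod (rees_incl_subproof p).

Fact rees_incl_linear : linear rees_incl.
Proof. by move=> a p p'; apply: val_inj. Qed.

HB.instance Definition _ :=
  GRing.isLinear.Build _ _ _ _ rees_incl rees_incl_linear.

Lemma rees_irrelevantX k (a : rees_ring I) : idealX (rees_irrelevant I) k a ->
  forall q, (a : {mpoly R[s]})@_q != 0 -> (mnm_const k <= q)%MM.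
Proof.
elim: k a => [|k IH] a.
  by move=> _ q _; apply/mnm_const_leP.
pose K : set (rees_ring I) :=
  [set a | forall q, (a : {mpoly R[s]})@_q != 0 -> (mnm_const k.+1 <= q)%MM].
suff: idealX (rees_irrelevant I) k.+1 `<=` K by apply.
have mulK (a1 a2 : rees_ring I) (j : nat) :
    (forall q, (a1 : {mpoly R[s]})@_q != 0 -> (mnm_const j <= q)%MM) ->
    (forall q, (a2 : {mpoly R[s]})@_q != 0 -> (mnm_const (k.+1 - j) <= q)%MM) ->
    K (a1 * a2).
  move=> H1 H2 q; apply: contraNT => nq; rewrite mcoeffM big1 // => -[p1 p2] /= /eqP E.
  have [->|/H1 /mnm_const_leP q1] := eqVneq (a1 : {mpoly R[s]})@_p1 0; first by rewrite mul0r.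
  have [->|/H2 /mnm_const_leP q2] := eqVneq (a2 : {mpoly R[s]})@_p2 0; first by rewrite mulr0.
  case/negP: nq; rewrite E; apply/mnm_const_leP => i; have := q1 i; have := q2 i.
  by rewrite mnmDE; lia.
apply: idealM_sub.
  split=> [q|a1 a2 H1 H2 q|a1 a2 H2].
  - by rewrite mcoeff0 eqxx.
  - apply: contraNT => nq; rewrite mcoeffD.
    have [->|/H1 H] := eqVneq (a1 : {mpoly R[s]})@_q 0; last by rewrite H in nq.
    have [->|/H2 H] := eqVneq (a2 : {mpoly R[s]})@_q 0; last by rewrite H in nq.
    by rewrite addr0.
  - by apply: (mulK _ _ 0%N) => // q _; apply/mnm_const_leP.
move=> a1 a2 H1 /IH H2; apply: (mulK _ _ 1%N) => [q /H1 eq|q /H2]; last by rewrite subn1.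
by apply/mnm_const_leP => i; have := eq i; rewrite !ffunE lez_nat.
Qed.

Fact unit_term_subproof n x : x *: 'X_[n] \in rees_mod_pred unit_filtration.
Proof. exact/rees_mod_predP. Qed.

(** The condition on [x] says that it lies in the Ratliff-Rush closure of
    [F(n)].  The augmentation [R(F) -> E_0] extends to [h : R[t] -> E_0]; all large
    multiples of [x t^n] lie in [R(F)], so the differential of [z = h(x t^n)]
    is a torsion cocycle.  It is then the differential of a torsion element
    [w], and [z - w] comes from some [f] in [R(F)].  A power of [b t^e] killing
    [w] multiplies [x t^n] and [f] to the same element, and [b] is regular. *)
Lemma ratliff_rush_closed (E : injective_resolution (rees_gmod F)) n b x N :
  lc_vanishes (rees_irrelevant I) E 1 (Zs_mnm n) ->
  ideals_pow I (Zs_mnm (mnm_const 1)) b -> (forall y, b * y = 0 -> y = 0) ->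
  (forall q u, (mnm_const N <= q)%MM -> ideals_pow I (Zs_mnm q) u ->
     F (Zs_mnm (q + n)%MM) (u * x)) ->
  F (Zs_mnm n) x.
Proof.
move=> lc0 Ib regb Hx.
have incl_inj : injective rees_incl.
  by move=> p p' /(congr1 (@rees_mod_val _ _ _ _)) E'; apply: val_inj.
have [h hgr hE] : exists2 h : {linear rees_gmod unit_filtration -> E 0},
    graded h & forall p, h (rees_incl p) = res_aug E p.
  apply: (@res_inj _ _ _ _ E 0 _ _ rees_incl (res_aug E)) => //.
  exact: res_aug_graded.
pose xt : rees_gmod unit_filtration := ReesMod (unit_term_subproof n x).
have xtn : gcomp (Zs_mnm n) xt.
  move=> q /=; rewrite mcoeffZ mcoeffX; have [<-//|_] := eqVneq n q.
  by rewrite mulr0 eqxx.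
have mulxt (a : rees_ring I) : idealX (rees_irrelevant I) N a ->
    exists p : rees_gmod F, rees_incl p = a *: xt.
  move=> /rees_irrelevantX aN.
  have Pp : (a : {mpoly R[s]}) * (x *: 'X_[n]) \in rees_mod_pred F.
    apply/rees_mod_predP => k; apply: ideal_mcoeffM; first exact: fil_ideal.
    move=> q q' ->; rewrite mcoeffZ mcoeffX.
    have [<-|_] := eqVneq; last by rewrite !mulr0; case: (fil_ideal F (Zs_mnm (q + q')%MM)).
    have [->|/aN Nq] := eqVneq (a : {mpoly R[s]})@_q 0.
      by rewrite mul0r; case: (fil_ideal F (Zs_mnm (q + n)%MM)).
    rewrite mulr1; apply: Hx => //; exact: (rees_predP _ _ (valP a)).
  by exists (ReesMod Pp); apply: val_inj.
pose z := h xt.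
have [w [[K Kw] _] dw] : 
    @lc_coboundaries _ _ _ _ (rees_irrelevant I) E 1 (Zs_mnm n) (res_d E 0 z).
  apply: lc0; split.
  - exists N => a /mulxt [p Ep].
    rewrite -linearZ -linearZ -Ep hE; apply/res_exact0; by exists p.
  - by apply: res_d_graded; exact: hgr.
  - by apply/res_exact; exists z.
have [f Ef] : exists f, res_aug E f = z - w.
  by apply/res_exact0; rewrite linearB /= dw subrr.
pose M := maxn N K.
have Pbt : b *: 'X_[mnm_const 1] \in rees_pred I.
  apply/rees_predP => q; rewrite mcoeffZ mcoeffX.
  have [<-|_] := eqVneq; first by rewrite mulr1.
  by rewrite mulr0; case: (ideals_pow_ideal I (Zs_mnm q)).
pose bt : rees_ring I := ReesRing Pbt.
have btX : idealX (rees_irrelevant I) M (bt ^+ M).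
  apply: idealX_expr => q; rewrite mcoeffZ mcoeffX.
  have [<- _|_] := eqVneq (mnm_const 1) q; last by rewrite mulr0 eqxx.
  by move=> i; rewrite !ffunE mnmE.
have [p Ep] := mulxt _ (idealXS (leq_maxl _ _) btX).
have {Ep}Ep : (bt ^+ M : rees_ring I) *: xt = rees_incl (bt ^+ M *: f).
  rewrite -Ep; congr rees_incl; apply: (@res_aug_inj _ _ _ _ E).
  rewrite linearZ_LR Ef scalerBr (Kw _ (idealXS (leq_maxr _ _) btX)) subr0.
  by rewrite -hE Ep linearZ_LR.
have btE : rees_val (bt ^+ M) = b ^+ M *: 'X_[mnm_const 1 *+ M].
  elim: (M) => [|k IH]; first by rewrite !expr0 scale1r mulm0n mpolyX0.
  by rewrite exprS /= IH mulmS mpolyXD exprS -scalerAl -scalerAr scalerA.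
have regM k y : b ^+ k * y = 0 -> y = 0.
  by elim: k y => [|k IH] y; rewrite ?expr0 ?mul1r // exprS -mulrA => /regb /IH.
have coefM (r : {mpoly R[s]}) :
    (rees_val (bt ^+ M) * r)@_(n + mnm_const 1 *+ M)%MM = b ^+ M * r@_n.
  by rewrite btE -scalerAl mcoeffZ [_ * r]mulrC addmC mcoeffMX.
have := congr1 (fun r : rees_mod unit_filtration =>
  (r : {mpoly R[s]})@_(n + mnm_const 1 *+ M)%MM) Ep.
rewrite /= !coefM mcoeffZ mcoeffX eqxx mulr1 => /eqP.
rewrite -subr_eq0 -mulrBr => /eqP /regM /subr0_eq ->.
exact: (rees_mod_predP _ _ (valP f)).
Qed.

End LocalCohomology.

(** * Hilbert polynomials *)

Section HilbertPolynomial.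
Context {s : nat}.
Implicit Types (n al : 'X_{1..s}).

(** The value of [binom_poly i a] where [X_i] is [k]. *)
Definition rising (k a : nat) : rat := (a`!%:R)^-1 * \prod_(j < a) (k%:R + j%:R).

Definition risings n al : rat := \prod_(i < s) rising (n i) (al i).

Lemma rising0 k : rising k 0 = 1.
Proof. by rewrite /rising big_ord0 fact0 invr1 mulr1. Qed.

Lemma rising1 k : rising k 1 = k%:R.
Proof. by rewrite /rising big_ord1 invr1 mul1r addr0. Qed.

Lemma rising_0S a : rising 0 a.+1 = 0.
Proof. by rewrite /rising big_ord_recl addr0 mul0r mulr0. Qed.

Lemma rising_diff k a : rising k.+1 a.+1 - rising k a.+1 = rising k.+1 a.
Proof.
rewrite /rising; set p : rat := \prod_(j < a) (k.+1%:R + j%:R).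
have -> : \prod_(j < a.+1) (k.+1%:R + j%:R) = p * (k%:R + 1 + a%:R) :> rat.
  by rewrite big_ord_recr /= natr1.
have -> : \prod_(j < a.+1) (k%:R + j%:R) = k%:R * p :> rat.
  rewrite big_ord_recl addr0; congr (_ * _); apply: eq_bigr => j _.
  by rewrite lift0 -!natrD addSnnS.
rewrite factS natrM -natr1.
have f0 : a`!%:R != 0 :> rat by rewrite pnatr_eq0 -lt0n fact_gt0.
have a0 : a%:R + 1 != 0 :> rat by rewrite natr1 pnatr_eq0.
by field; rewrite f0.
Qed.

Lemma risings_U n i : risings n U_(i)%MM = (n i)%:R.
Proof.
rewrite /risings (bigD1 i) //= mnm1E eqxx rising1 big1 ?mulr1 // => j ji.
by rewrite mnm1E eq_sym (negPf ji) rising0.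
Qed.

Lemma risings_diff n i al : risings (U_(i) + n)%MM al - risings n al =
  if al i == 0%N then 0 else risings (U_(i) + n)%MM (al - U_(i))%MM.
Proof.
have E al' : (forall j, j != i -> al' j = al j) ->
    \prod_(j < s | j != i) rising ((U_(i) + n)%MM j) (al' j) =
    \prod_(j < s | j != i) rising (n j) (al j).
  move=> H; apply: eq_bigr => j ji.
  by rewrite H // mnmDE mnm1E eq_sym (negPf ji).
rewrite /risings (bigD1 i) //= [X in _ - X](bigD1 i) //= E // mnmDE mnm1E eqxx add1n.
case Ea: (al i) => [|a]; first by rewrite /= !rising0 subrr.
rewrite -mulrBl rising_diff [RHS](bigD1 i) //= mnmDE mnm1E eqxx add1n.
congr (_ * _); first by rewrite mnmBE Ea mnm1E eqxx subn1.
by rewrite E // => j ji; rewrite mnmBE mnm1E eq_sym (negPf ji) subn0.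
Qed.

Lemma risings0l al : al != 0%MM -> risings 0%MM al = 0.
Proof.
move=> al0; have [i] : exists i, al i != 0%N.
  apply/existsP; apply: contraNT al0; rewrite negb_exists => /forallP H.
  by apply/eqP/mnmP => i; rewrite mnm0E; apply/eqP; have := H i; rewrite negbK.
case E : (al i) => [//|a] _.
by rewrite /risings (bigD1 i) //= E mnm0E rising_0S mul0r.
Qed.

Lemma risings0r n : risings n 0%MM = 1.
Proof. by rewrite /risings big1 // => i _; rewrite mnm0E rising0. Qed.

Lemma Zs_eval_hilbert d P e n : @hilbert_coefs s d P e ->
  Zs_eval P (Zs_mnm n) = \sum_(al : 'X_{1..s < d.+1})
    (-1) ^+ (d - mdeg al) * (e al)%:~R * risings n al.
Proof.
move=> ->; rewrite /Zs_eval raddf_sum /=; apply: eq_bigr => al _.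
rewrite mevalZ; congr (_ * _); rewrite rmorph_prod /=; apply: eq_bigr => i _.
rewrite /binom_poly mevalZ; congr (_ * _); rewrite rmorph_prod /=.
apply: eq_bigr => j _; rewrite rmorphD /= mevalXU rmorph_nat ffunE.
by rewrite -pmulrn.
Qed.

Lemma linear_form_sum (T : Type) (r : seq T) (f : T -> 'X_{1..s} -> rat) :
  (forall t, exists c, forall n, f t n = linear_form c n) ->
  exists c, forall n, \sum_(t <- r) f t n = linear_form c n.
Proof.
move=> H; elim: r => [|t r [c Hc]].
  exists (fun=> 0) => n; rewrite big_nil /linear_form big1 // => i _.
  by rewrite mul0r.
have [c' Hc'] := H t; exists (fun i => c' i + c i) => n.
rewrite big_cons Hc Hc' -big_split /=; apply: eq_bigr => i _.
by rewrite mulrDl.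
Qed.

Lemma linear_form_scale k c :
  exists c', forall n, k * linear_form c n = linear_form c' n.
Proof.
exists (fun i => k * c i) => n; rewrite mulr_sumr; apply: eq_bigr => i _.
by rewrite mulrA.
Qed.

Lemma risings_linear al : mdeg al = 1%N ->
  exists c, forall n, risings n al = linear_form c n.
Proof.
move=> /eqP /mdeg1P [i /eqP ->]; exists (fun j => (j == i)%:R) => n.
rewrite risings_U /linear_form (bigD1 i) //= eqxx mul1r big1 ?addr0 // => j ji.
by rewrite (negPf ji) mul0r.
Qed.

Lemma linear_form_zero : exists c, forall n, 0 = linear_form c n.
Proof.
by exists (fun=> 0) => n; rewrite /linear_form big1 // => i _; rewrite mul0r.
Qed.

Lemma hilbert_linear P e : @hilbert_coefs s 1 P e -> e 0%MM = 0 ->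
  exists c, forall n, Zs_eval P (Zs_mnm n) = linear_form c n.
Proof.
move=> HP e0.
pose f (al : 'X_{1..s < 2}) n : rat :=
  (-1) ^+ (1 - mdeg al) * (e al)%:~R * risings n al.
have [|c Hc] := linear_form_sum (index_enum _) (f := f); last first.
  by exists c => n; rewrite (Zs_eval_hilbert _ HP) Hc.
move=> al; have := bmdeg al; rewrite ltnS leq_eqVlt => /predU1P [al1|].
  have [c Hc] := risings_linear al1.
  have [c' Hc'] := linear_form_scale ((-1) ^+ (1 - mdeg al) * (e al)%:~R) c.
  by exists c' => n; rewrite /f Hc Hc'.
rewrite ltnS leqn0 mdeg_eq0 => /eqP al0.
have [c Hc] := linear_form_zero; exists c => n.
by rewrite /f al0 e0 mulr0 mul0r -Hc.
Qed.

(** Pascal's rule lowers each term of degree [2] of the Hilbert polynomial to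
    a term of degree [1]; those of degree [1] vanish by hypothesis and that of
    degree [0] cancels. *)
Lemma hilbert_diff_linear P e i : @hilbert_coefs s 2 P e ->
  (forall j, e U_(j)%MM = 0) ->
  exists c, forall n, Zs_eval P (Zs_mnm (U_(i) + n)%MM) - Zs_eval P (Zs_mnm n) =
    linear_form c (U_(i) + n)%MM.
Proof.
move=> HP e1.
pose f (al : 'X_{1..s < 3}) n : rat := if (mdeg al == 2%N) && (al i != 0%N)
  then (e al)%:~R * risings n (al - U_(i))%MM else 0.
have [|c Hc] := linear_form_sum (index_enum _) (f := f).
  move=> al; have [Hal|nal] := boolP ((mdeg al == 2%N) && (al i != 0%N)).
    have /andP [/eqP al2 ali] := Hal.
    have al1 : mdeg (al - U_(i))%MM = 1%N.
      have : mdeg ((al - U_(i)) + U_(i))%MM = 2%N.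
        rewrite submK //; apply/mnm_lepP => j; rewrite mnm1E.
        by case: eqP => [<-|//]; rewrite lt0n.
      by rewrite mdegD mdeg1; lia.
    have [c Hc] := risings_linear al1.
    have [c' Hc'] := linear_form_scale (e al)%:~R c.
    by exists c' => n; rewrite /f Hal Hc Hc'.
  by have [c Hc] := linear_form_zero; exists c => n; rewrite /f (negPf nal) -Hc.
exists c => n; rewrite -Hc !(Zs_eval_hilbert _ HP) -sumrB.
apply: eq_bigr => al _; rewrite -mulrBr risings_diff /f.
have := bmdeg al; rewrite ltnS leq_eqVlt => /predU1P [al2|].
  rewrite al2 eqxx /=; case: eqP => _ /=; first by rewrite mulr0.
  by rewrite mul1r.
rewrite ltnS leq_eqVlt => /predU1P [al1|].
  have /mdeg1P [j /eqP ->] : mdeg al == 1%N by apply/eqP.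
  by rewrite e1 mulr0 mul0r mdeg1.
rewrite ltnS leqn0 mdeg_eq0 => /eqP ->.
by rewrite mnm0E eqxx mulr0 andbF.
Qed.

Lemma hilbert_at0 P e : @hilbert_coefs s 2 P e ->
  Zs_eval P (Zs_mnm 0%MM) = (e 0%MM)%:~R.
Proof.
move=> HP; rewrite (Zs_eval_hilbert _ HP).
have p0 : (mdeg (0%MM : 'X_{1..s}) < 3)%N by rewrite mdeg0.
rewrite (bigD1 (BMultinom p0)) //= big1 ?addr0 => [|al al0].
  by rewrite risings0r mdeg0 mulr1 expr2 mulrNN !mul1r.
by rewrite risings0l ?mulr0 //; apply: contraNneq al0 => al0; apply/eqP/val_inj.
Qed.

End HilbertPolynomial.

(** * The theorem *)

Section SocleFree.
Context {R : comNzRingType} (m : set R).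
Implicit Types (a x y : R).

Lemma socle_free0 a : m a -> (forall x, a * x = 0 -> x = 0) ->
  socle_free m [set 0].
Proof. by move=> ma rega x /(_ a ma) /= /rega. Qed.

(** For [x] killed by [m] modulo [a], write [y1 x = a u] and [y2 x = a v].  Then
    [y1 v = y2 u], because [a] is regular, so [u = y1 w] by regularity of the
    sequence [y1, y2], and [x = a w]. *)
Lemma socle_free_principal y1 y2 a : m y1 -> m y2 ->
  (forall x, y1 * x = 0 -> x = 0) ->
  (forall x, principal y1 (y2 * x) -> principal y1 x) ->
  (forall x, a * x = 0 -> x = 0) -> socle_free m (principal a).
Proof.
move=> m1 m2 reg1 reg2 rega x Hx.
have [u _ Eu] := Hx _ m1; have [v _ Ev] := Hx _ m2.
have E : y1 * v = y2 * u.
  apply/eqP; rewrite -subr_eq0; apply/eqP; apply: rega.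
  by rewrite mulrBr mulrCA Ev [a * (y2 * u)]mulrCA Eu; ring.
have [w _ Ew] : principal y1 u by apply: reg2; exists v.
exists w => //; apply/eqP; rewrite -subr_eq0; apply/eqP; apply: reg1.
by rewrite mulrBr -Eu -Ew; ring.
Qed.

End SocleFree.

Section DimensionTwo.
Context {R : comNzRingType} (m : set R) {s : nat} (I : 'I_s -> set R)
  (F : filtration I).
Hypotheses (nR : noetherian R) (locm : local_ring m)
  (infm : infinite_residue_field m) (rI : forall i, is_primary_to m (I i))
  (aF : admissible F).
Context (y1 y2 : R).
Hypotheses (m1 : m y1) (m2 : m y2) (reg1 : forall x, y1 * x = 0 -> x = 0)
  (reg2 : forall x, principal y1 (y2 * x) -> principal y1 x).
Context (P : {mpoly rat[s]}) (i : 'I_s) (c : 'I_s -> rat) (N : nat).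
Hypotheses (HP : forall n, (mnm_const N <= n)%MM ->
    Zs_eval P (Zs_mnm n) = (hilbert_fun F (Zs_mnm n))%:R)
  (HPc : forall n, Zs_eval P (Zs_mnm (U_(i) + n)%MM) - Zs_eval P (Zs_mnm n) =
    linear_form c (U_(i) + n)%MM).
Implicit Types (n q : 'X_{1..s}).

Notation G n := (F (Zs_mnm n)).

(** For [a] in [I_i] superficial, [l(R/(F(n) + aR))] has the linear Hilbert
    polynomial [P(n) - P(n - e_i)] without constant term, and therefore equals
    it for all [n].  As [(F(n + e_i) : a) = F(n)] for all [n] when the ideals
    [F(n)] are Ratliff-Rush closed, [P] and [l(R/F)] have the same increments. *)
Lemma hilbert_increment (E : injective_resolution (rees_gmod F)) :
  (forall n, lc_vanishes (rees_irrelevant I) E 1 (Zs_mnm n)) ->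
  forall n, (hilbert_fun F (Zs_mnm (U_(i) + n)%MM))%:R - Zs_eval P (Zs_mnm (U_(i) + n)%MM)
    = (hilbert_fun F (Zs_mnm n))%:R - Zs_eval P (Zs_mnm n).
Proof.
move=> lc0.
have [a [Ia rega [N1 HN1]]] :=
  superficial_exists nR locm infm rI aF i ideal0 (socle_free0 m1 reg1).
have {}HN1 n x : (mnm_const N1 <= n)%MM -> G (U_(i) + n)%MM (a * x) -> G n x.
  by move=> n1; have := HN1 n x n1; rewrite !idealD0.
have iG n : ideal (G n) by exact: fil_ideal.
have Ga n x : G n x -> G (U_(i) + n)%MM (a * x).
  by move=> Gx; apply: fil_mnmM => //; exact: fil_mnm_gen.
have ia := principal_ideal a.
have finG n : finite_length (G n).
  by have := finite_length_fil F nR locm rI n ideal0; rewrite idealD0.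
have add n : (forall x, G (U_(i) + n)%MM (a * x) -> G n x) ->
    hilbert_fun F (Zs_mnm (U_(i) + n)%MM) = (hilbert_fun F (Zs_mnm n) +
      lambda_quot (idealD (G (U_(i) + n)%MM) (principal a)))%N.
  move=> Hn; have cE : colon (G (U_(i) + n)%MM) a = G n.
    by rewrite eqEsubset; split=> x; [exact: Hn|exact: Ga].
  have := lambda_quot_colon (b := a) (iG (U_(i) + n)%MM).
  rewrite cE => H; apply: (proj2 (H (finG n) _)).
  exact: (finite_length_fil F nR locm rI _ ia).
have sfa : socle_free m (principal a) := socle_free_principal m1 m2 reg1 reg2 rega.
have lin := linear_hilbert_fun nR locm infm rI aF (c := c) ia sfa.
have {}lin n : (lambda_quot (idealD (G n) (principal a)))%:R = linear_form c n.
  apply: lin; exists (maxn N N1).+1 => {}n /mnm_const_leP Nn.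
  have [q En] : exists q, n = (U_(i) + q)%MM.
    exists (n - U_(i))%MM; rewrite addmC submK //; apply/mnm_lepP => j.
    by rewrite mnm1E; case: eqP => // _; have := Nn j; lia.
  have Nq j : (maxn N N1 <= q j)%N.
    by have := Nn j; rewrite En mnmDE mnm1E; case: (i == j) => /=; lia.
  have q0 : (mnm_const N <= q)%MM.
    by apply/mnm_const_leP => j; have := Nq j; lia.
  have q1 : (mnm_const N1 <= q)%MM.
    by apply/mnm_const_leP => j; have := Nq j; lia.
  have := congr1 (fun k : nat => k%:R : rat) (add q (fun x => HN1 q x q1)).
  rewrite natrD -!HP // -?En; last by rewrite En; exact: lepm_trans q0 (lem_addl _ _).
  by move=> H; rewrite En -HPc -En H addrC addKr.
move=> n; rewrite add.
  by rewrite natrD lin -HPc; ring.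
move=> x Gax.
have [k Ik] := ideals_pow_nilpotent (mnm_const 1) (fun i => proj2 (rI i)) m1.
apply: (ratliff_rush_closed (N := N1) (lc0 n) Ik).
  by elim: k {Ik} => [|k IH] y; rewrite ?expr0 ?mul1r // exprS -mulrA => /reg1 /IH.
move=> q u Nq Iu; apply: HN1; first exact: lepm_trans Nq (lem_addr _ _).
have := fil_mnmM (@fil_pow _ _ _ F _ _ Iu) Gax; rewrite mulrCA; congr (F (Zs_mnm _) _).
by rewrite !addmA (addmC q).
Qed.

End DimensionTwo.

Lemma Zs_nneg s (n : Zs s) : Zs_le 0 n -> exists q, n = Zs_mnm q.
Proof.
move=> n0; exists [multinom `|n i|%N | i < s]; apply/ffunP => i.
by rewrite ffunE mnmE gez0_abs //; have := n0 i; rewrite ffunE.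
Qed.

Theorem theorem1p10 (R : comNzRingType) (m : set R) (d s : nat)
    (I : 'I_s -> set R) (F : filtration I)
    (P : {mpoly rat[s]}) (e : 'X_{1..s} -> int) :
  (1 <= s)%N -> (1 <= d <= 2)%N ->
  cohen_macaulay_local m d ->
  infinite_residue_field m ->
  (forall i, is_primary_to m (I i)) ->
  admissible F ->
  hilbert_poly F d P -> hilbert_coefs d P e ->
  (forall i : 'I_s, e (U_(i) *+ d.-1)%MM = 0) ->
  (d = 1%N ->
     forall n : Zs s, Zs_le 0 n -> Zs_eval P n = (hilbert_fun F n)%:R) /\
  (d = 2%N ->
     forall E : injective_resolution (rees_gmod F),
       (forall n : Zs s, Zs_le 0 n ->
          lc_vanishes (rees_irrelevant I) E 1 n) ->
       (forall n : Zs s, Zs_le 0 n -> Zs_eval P n = (hilbert_fun F n)%:R) /\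
       e 0%MM = 0).

Proof.
move=> s0 d12 [nR locm _ [[X [szX mX [regX _]]] _]] infm rI aF [_ [N HN]] HP e0.
pose i0 : 'I_s := Ordinal s0.
have {}HN n : (mnm_const N <= n)%MM ->
    Zs_eval P (Zs_mnm n) = (hilbert_fun F (Zs_mnm n))%:R.
  by move=> /mnm_const_leP Nn; apply: HN => i; rewrite ffunE lez_nat.
have nth_m i : (i < d)%N -> m X`_i by move=> id; apply: mX; rewrite mem_nth // szX.
have d0 : (0 < d)%N by case/andP: d12.
have reg0 x : X`_0 * x = 0 -> x = 0.
  move=> X0; have := regX 0%N; rewrite szX => /(_ d0 x) /=; rewrite X0.
  case: (ideal_gen_ideal [set y | y \in take 0 X]) => G0 _ _ /(_ G0).
  by apply: (ideal_gen_sub ideal0); rewrite take0.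
split=> [d1|d2].
  rewrite d1 in szX nth_m HP e0.
  have [c Hc] : exists c, forall n, Zs_eval P (Zs_mnm n) = linear_form c n.
    by apply: (hilbert_linear HP); have := e0 i0; rewrite mulm0n.
  move=> _ /Zs_nneg [n ->].
  rewrite Hc -(linear_hilbert_fun nR locm infm rI aF (c := c) ideal0
    (socle_free0 (nth_m 0%N isT) reg0)) ?idealD0 //.
  by exists N => q /HN; rewrite Hc => ->; rewrite idealD0.
move=> E lc0; rewrite d2 in szX nth_m HP e0.
have reg1 x : principal X`_0 (X`_1 * x) -> principal X`_0 x.
  have <- : ideal_gen [set y | y \in take 1 X] = principal X`_0.
    case: X szX {mX regX nth_m reg0} => [|y1 [|y2 [|]]] //= _.
    rewrite eqEsubset; split.
      apply: ideal_gen_sub; first exact: principal_ideal.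
      by move=> y /=; rewrite inE => /eqP ->; exact: principal_id.
    have [_ _ GM] := ideal_gen_ideal [set y | y \in take 1 [:: y1; y2]].
    move=> _ [r _ <-]; rewrite mulrC; apply: GM.
    by apply: ideal_gen_mem; rewrite /= mem_head.
  by apply: regX; rewrite szX.
have e1 j : e U_(j)%MM = 0 by have := e0 j; rewrite mulm1n.
pose D n : rat := (hilbert_fun F (Zs_mnm n))%:R - Zs_eval P (Zs_mnm n).
have Dconst q n : D (q + n)%MM = D n.
  elim/mnm_nat_ind: q => [|i q IH]; first by rewrite add0m.
  have [c Hc] := hilbert_diff_linear i HP e1.
  rewrite -IH -addmA; apply: (hilbert_increment nR locm infm rI aF (nth_m 0%N isT)
    (nth_m 1%N isT) reg0 reg1 HN Hc (E := E)) => k.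
  by apply: lc0 => j; rewrite !ffunE.
have PH n : Zs_eval P (Zs_mnm n) = (hilbert_fun F (Zs_mnm n))%:R.
  apply/esym/eqP; rewrite -subr_eq0 -/(D n) -(Dconst (mnm_const N) n).
  by rewrite /D HN ?subrr // lem_addr.
split; first by move=> _ /Zs_nneg [n ->]; exact: PH.
apply/eqP; rewrite -(intr_eq0 rat) -(hilbert_at0 HP) PH.
by rewrite /hilbert_fun lambda_quot1 //; exact: fil_mnm0.
Qed.
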